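(* Let $f=\mathcal{I}(F):\Omega_D\to\mathbb{H}$ be an injective slice regular function. Then its slice derivative is never zero: $\frac{\partial f}{\partial x}(x)\neq 0$ for every $x\in\Omega_D$.
   Context: $\mathbb{H}$ is the real algebra of quaternions and $\mathbb{S}=\{q\in\mathbb{H} : q^2=-1\}$ its sphere of imaginary units; every $x\in\mathbb{H}$ can be written $x=\alpha+I\beta$ with $\alpha,\beta\in\mathbb{R}$, $I\in\mathbb{S}$. $D\subset\mathbb{C}$ is an open set symmetric with respect to the real axis, and $\Omega_D:=\{\alpha+J\beta\in\mathbb{H} : \alpha+i\beta\in D,\ J\in\mathbb{S}\}$ is its circularization ($\Omega_D$ may or may not meet $\mathbb{R}$). Let $\mathbb{H}_{\mathbb{C}}=\mathbb{H}\otimes_{\mathbb{R}}\mathbb{C}=\{p+\sqrt{-1}q : p,q\in\mathbb{H}\}$. A stem function on $D$ is a map $F=F_1+\sqrt{-1}F_2:D\to\mathbb{H}_{\mathbb{C}}$ ($F_1,F_2$ being $\mathbb{H}$-valued) with $F_1(\bar z)=F_1(z)$ and $F_2(\bar z)=-F_2(z)$ for all $z\in D$. It induces the slice function $f=\mathcal{I}(F):\Omega_D\to\mathbb{H}$, $f(\alpha+J\beta):=F_1(\alpha+i\beta)+JF_2(\alpha+i\beta)$. The slice function $f=\mathcal{I}(F)$ is slice regular if $F$ is of class $\mathcal{C}^1$ and $\partial F/\partial\bar z=\frac12\left(\frac{\partial F}{\partial\alpha}+\sqrt{-1}\frac{\partial F}{\partial\beta}\right)\equiv 0$ on $D$. The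 slice derivative of $f$ is the slice function $\frac{\partial f}{\partial x}:=\mathcal{I}\left(\frac{\partial F}{\partial z}\right)$, where $\frac{\partial F}{\partial z}=\frac12\left(\frac{\partial F}{\partial\alpha}-\sqrt{-1}\frac{\partial F}{\partial\beta}\right)$; equivalently $\frac{\partial f}{\partial x}(\alpha+J\beta)=\frac12\left(\frac{\partial F_1}{\partial\alpha}+\frac{\partial F_2}{\partial\beta}-J\left(\frac{\partial F_1}{\partial\beta}-\frac{\partial F_2}{\partial\alpha}\right)\right)(\alpha+i\beta)$. *)

(* Defs.v *)
From Stdlib Require Import Reals Lra.
From Coquelicot Require Import Coquelicot.
Open Scope R_scope.

(** Quaternions [a + b i + c j + d k] as quadruples of reals; the addition,
    real scaling and topology are those of the product normed module R^4. *)
Definition quat : Type := (R * R * R * R)%type.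

Definition qre (q : quat) : R := let '(a, _, _, _) := q in a.
Definition qi (q : quat) : R := let '(_, b, _, _) := q in b.
Definition qj (q : quat) : R := let '(_, _, c, _) := q in c.
Definition qk (q : quat) : R := let '(_, _, _, d) := q in d.

Definition qreal (r : R) : quat := (r, 0, 0, 0).

Definition qmul (p q : quat) : quat :=
  let '(a1, b1, c1, d1) := p in
  let '(a2, b2, c2, d2) := q in
  (a1 * a2 - b1 * b2 - c1 * c2 - d1 * d2,
   a1 * b2 + b1 * a2 + c1 * d2 - d1 * c2,
   a1 * c2 - b1 * d2 + c1 * a2 + d1 * b2,
   a1 * d2 + b1 * c2 - c1 * b2 + d1 * a2).

Definition imag_unit (J : quat) : Prop := qmul J J = qreal (-1).

(** The point [alpha + J beta] of H. *)
Definition slice_pt (alpha beta : R) (J : quat) : quat :=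
  plus (qreal alpha) (scal beta J).

Definition circularization (D : C -> Prop) (x : quat) : Prop :=
  exists (alpha beta : R) (J : quat),
    D (alpha, beta) /\ imag_unit J /\ x = slice_pt alpha beta J.

Definition conj_symmetric (D : C -> Prop) : Prop :=
  forall z, D z -> D (Cconj z).

(** [(p, q)] stands for [p + sqrt(-1) q]; only the structure of complex vector
    space of H_C is needed. *)
Definition quatC : Type := (quat * quat)%type.

Definition mul_sqrtm1 (w : quatC) : quatC := (opp (snd w), fst w).

Definition is_stem (D : C -> Prop) (F : C -> quatC) : Prop :=
  forall z, D z ->
    fst (F (Cconj z)) = fst (F z) /\ snd (F (Cconj z)) = opp (snd (F z)).

(** [imag_dir x] is the J with [x = Re x + J |Im x|], and i when x is real. *)
Definition imag_norm (x : quat) : R := sqrt (qi x ^ 2 + qj x ^ 2 + qk x ^ 2).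

Definition imag_dir (x : quat) : quat :=
  if Req_EM_T (imag_norm x) 0 then (0, 1, 0, 0)
  else (0, qi x / imag_norm x, qj x / imag_norm x, qk x / imag_norm x).

(** The slice function I(F), computed from one representation of x; by
    [slice_fun_slice_pt] below, on the circularization of D the choice is
    immaterial when F is a stem function.  Outside it the value is junk. *)
Definition slice_fun (F : C -> quatC) (x : quat) : quat :=
  let w := F (qre x, imag_norm x) in
  plus (fst w) (qmul (imag_dir x) (snd w)).

(** Coquelicot's [Derive] is real-valued, hence the componentwise definition. *)
Definition Derive_quat (g : R -> quat) (t : R) : quat :=
  (Derive (fun s => qre (g s)) t, Derive (fun s => qi (g s)) t,
   Derive (fun s => qj (g s)) t, Derive (fun s => qk (g s)) t).

Definition Derive_quatC (g : R -> quatC) (t : R) : quatC :=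
  (Derive_quat (fun s => fst (g s)) t, Derive_quat (fun s => snd (g s)) t).

Definition d_alpha (F : C -> quatC) (z : C) : quatC :=
  Derive_quatC (fun s => F (s, Im z)) (Re z).

Definition d_beta (F : C -> quatC) (z : C) : quatC :=
  Derive_quatC (fun s => F (Re z, s)) (Im z).

Definition class_C1 (D : C -> Prop) (F : C -> quatC) : Prop :=
  forall z, D z ->
    ex_derive (fun s : R => F (s, Im z)) (Re z) /\
    ex_derive (fun s : R => F (Re z, s)) (Im z) /\
    continuous (d_alpha F) z /\
    continuous (d_beta F) z.

Definition d_zbar (F : C -> quatC) (z : C) : quatC :=
  scal (/ 2) (plus (d_alpha F z) (mul_sqrtm1 (d_beta F z))).

Definition d_z (F : C -> quatC) (z : C) : quatC :=
  scal (/ 2) (minus (d_alpha F z) (mul_sqrtm1 (d_beta F z))).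

(** Slice regularity of [slice_fun F], for a stem function F on D. *)
Definition slice_regular (D : C -> Prop) (F : C -> quatC) : Prop :=
  class_C1 D F /\ forall z, D z -> d_zbar F z = zero.

Definition slice_derivative (F : C -> quatC) : quat -> quat :=
  slice_fun (d_z F).

Lemma quat_eq (p q : quat) :
  qre p = qre q -> qi p = qi q -> qj p = qj q -> qk p = qk q -> p = q.
Proof.
destruct p as [[[a b] c] d]; destruct q as [[[a' b'] c'] d']; simpl.
intros; subst; reflexivity.
Qed.

Lemma imag_unitP (J : quat) :
  imag_unit J <-> qre J = 0 /\ qi J ^ 2 + qj J ^ 2 + qk J ^ 2 = 1.
Proof.
destruct J as [[[a b] c] d]; unfold imag_unit, qreal; simpl; split.
- intros H; injection H; intros H4 H3 H2 H1.
  assert (Ha : a = 0).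
  { destruct (Req_dec a 0) as [|Na]; [assumption|exfalso].
    assert (b = 0) by (apply (Rmult_eq_reg_l a); lra).
    assert (c = 0) by (apply (Rmult_eq_reg_l a); lra).
    assert (d = 0) by (apply (Rmult_eq_reg_l a); lra).
    subst; nra. }
  subst; split; lra.
- intros [-> H]; repeat f_equal; lra.
Qed.

Lemma imag_norm_slice_pt (alpha beta : R) (J : quat) :
  imag_unit J -> imag_norm (slice_pt alpha beta J) = Rabs beta.
Proof.
intros HJ; apply imag_unitP in HJ; destruct J as [[[a b] c] d].
destruct HJ as [Ha H]; simpl in Ha, H; subst a.
unfold imag_norm; rewrite <- sqrt_Rsqr_abs; f_equal.
unfold Rsqr; simpl; unfold plus, scal, mult; simpl; unfold mult; simpl.
replace (beta * beta) with (beta * beta * (b * (b * 1) + c * (c * 1) + d * (d * 1)))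
  by (rewrite H; ring).
ring.
Qed.

Lemma slice_fun_slice_pt (D : C -> Prop) (F : C -> quatC)
    (alpha beta : R) (J : quat) :
  is_stem D F -> D (alpha, beta) -> imag_unit J ->
  slice_fun F (slice_pt alpha beta J) =
  plus (fst (F (alpha, beta))) (qmul J (snd (F (alpha, beta)))).
Proof.
intros HF HD HJ; unfold slice_fun.
assert (Hd : beta <> 0 -> imag_dir (slice_pt alpha beta J) =
              scal (beta / Rabs beta) J).
{ intros Nb; unfold imag_dir; rewrite imag_norm_slice_pt; [|assumption].
  assert (Nb' : Rabs beta <> 0) by (apply Rabs_no_R0; assumption).
  destruct (Req_EM_T (Rabs beta) 0) as [E|_]; [contradiction|].
  apply imag_unitP in HJ; destruct J as [[[a b] c] d].
  destruct HJ as [Ha _]; simpl in Ha; subst a.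
  apply quat_eq; simpl; unfold plus, scal, mult; simpl; unfold mult; simpl;
    field; assumption. }
assert (Hr : qre (slice_pt alpha beta J) = alpha).
{ apply imag_unitP in HJ; destruct J as [[[a b] c] d].
  destruct HJ as [Ha _]; simpl in Ha; subst a.
  simpl; unfold plus, scal, mult; simpl; unfold mult; simpl; ring. }
rewrite imag_norm_slice_pt; [|assumption].
rewrite Hr.
destruct (HF _ HD) as [H1 H2]; unfold Cconj in H1, H2; simpl in H1, H2.
destruct (Rtotal_order beta 0) as [Lt|[E|Gt]].
- rewrite Hd by (apply Rlt_not_eq; assumption); rewrite Rabs_left by assumption.
  rewrite H1, H2; f_equal.
  destruct J as [[[a b] c] d]; destruct (snd (F (alpha, beta))) as [[[a' b'] c'] d'].
  apply quat_eq; simpl; unfold opp, scal, mult; simpl; unfold opp, mult; simpl;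
    field; lra.
- subst beta; rewrite Rabs_R0; f_equal.
  rewrite Ropp_0 in H2.
  assert (Z : snd (F (alpha, 0)) = (0, 0, 0, 0)).
  { destruct (snd (F (alpha, 0))) as [[[a b] c] d].
    assert (E : (a, b, c, d) = (- a, - b, - c, - d)) by exact H2.
    injection E; intros; repeat f_equal; lra. }
  rewrite Z.
  destruct J as [[[a b] c] d]; destruct (imag_dir _) as [[[a' b'] c'] d'].
  apply quat_eq; simpl; ring.
- rewrite Hd by (apply Rgt_not_eq; assumption); rewrite Rabs_right by lra; f_equal.
  destruct J as [[[a b] c] d]; destruct (snd (F (alpha, beta))) as [[[a' b'] c'] d'].
  apply quat_eq; simpl; unfold scal, mult; simpl; unfold mult; simpl;
    field; lra.
Qed.

Lemma is_derive_linear {U V : NormedModule R_AbsRing} (l : U -> V)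
    (g : R -> U) (t : R) (y : U) :
  is_linear l -> is_derive g t y -> is_derive (fun s => l (g s)) t (l y).
Proof.
intros Hl Hg; unfold is_derive in *.
eapply filterdiff_ext_lin.
- apply (filterdiff_comp' g l t (fun s => scal s y) l); [exact Hg|].
  apply filterdiff_linear; exact Hl.
- intros s; simpl; exact (linear_scal l Hl s y).
Qed.

Lemma Derive_quat_correct (g : R -> quat) (t : R) (y : quat) :
  is_derive g t y -> Derive_quat g t = y.
Proof.
intros Hg.
assert (H1 := is_derive_linear _ _ _ _ is_linear_fst Hg).
assert (H2 := is_derive_linear _ _ _ _ is_linear_fst H1).
assert (Ha := is_derive_linear _ _ _ _ is_linear_fst H2).
assert (Hb := is_derive_linear _ _ _ _ is_linear_snd H2).
assert (Hc := is_derive_linear _ _ _ _ is_linear_snd H1).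
assert (Hd := is_derive_linear _ _ _ _ is_linear_snd Hg).
destruct y as [[[a b] c] d]; unfold Derive_quat; simpl in *.
repeat f_equal; apply is_derive_unique; eapply is_derive_ext; try eassumption;
  intros s; simpl; destruct (g s) as [[[a' b'] c'] d']; reflexivity.
Qed.

Lemma Derive_quatC_correct (g : R -> quatC) (t : R) (y : quatC) :
  is_derive g t y -> Derive_quatC g t = y.
Proof.
intros Hg; destruct y as [p q]; unfold Derive_quatC; f_equal;
  apply Derive_quat_correct.
- exact (is_derive_linear _ _ _ _ is_linear_fst Hg).
- exact (is_derive_linear _ _ _ _ is_linear_snd Hg).
Qed.

Definition conj_quatC (w : quatC) : quatC := (fst w, opp (snd w)).

Lemma is_linear_conj_quatC :
  is_linear (conj_quatC : prod_NormedModule R_AbsRing _ _ -> _).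
Proof.
apply (is_linear_prod (fun w : quatC => fst w) (fun w => opp (snd w))).
- exact is_linear_fst.
- apply (is_linear_comp (fun w : quatC => snd w) opp).
  + exact is_linear_snd.
  + apply is_linear_opp.
Qed.

Lemma is_stem_conj (D : C -> Prop) (F : C -> quatC) :
  is_stem D F <-> forall z, D z -> F (Cconj z) = conj_quatC (F z).
Proof.
split; intros H z Hz.
- destruct (H z Hz) as [H1 H2]; unfold conj_quatC.
  rewrite <- H1, <- H2; apply surjective_pairing.
- rewrite (H z Hz); split; reflexivity.
Qed.

(** Hence [slice_derivative F] is well defined as well. *)
Lemma is_stem_d_z (D : C -> Prop) (F : C -> quatC) :
  open D -> conj_symmetric D -> is_stem D F -> class_C1 D F ->
  is_stem D (d_z F).
Proof.
intros Dop Dsym HF HC1; apply is_stem_conj; intros [a b] Hz.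
rewrite is_stem_conj in HF.
assert (Hz' := Dsym _ Hz); unfold Cconj in Hz'; simpl in Hz'.
destruct (HC1 _ Hz) as [[la Ha] [[lb Hb] _]]; simpl in Ha, Hb.
assert (La : locally a (fun s : R => D (s, b))).
{ destruct (Dop _ Hz) as [e He]; exists e; intros s Hs; apply He.
  split; [exact Hs|apply ball_center]. }
assert (Lb : locally (- b) (fun s : R => D (a, s))).
{ destruct (Dop _ Hz') as [e He]; exists e; intros s Hs; apply He.
  split; [apply ball_center|exact Hs]. }
assert (Ea : d_alpha F (a, b) = la) by (apply Derive_quatC_correct; exact Ha).
assert (Eb : d_beta F (a, b) = lb) by (apply Derive_quatC_correct; exact Hb).
assert (Ea' : d_alpha F (Cconj (a, b)) = conj_quatC la).
{ apply Derive_quatC_correct; simpl.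
  eapply is_derive_ext_loc;
    [|exact (is_derive_linear _ _ _ _ is_linear_conj_quatC Ha)].
  eapply filter_imp; [|exact La]; intros s Hs; symmetry; exact (HF _ Hs). }
assert (Eb' : d_beta F (Cconj (a, b)) = scal (-1) (conj_quatC lb)).
{ apply Derive_quatC_correct; simpl.
  apply is_derive_ext_loc with (fun s : R => conj_quatC (F (a, - s))).
  - eapply filter_imp; [|exact Lb]; intros s Hs.
    assert (E := HF _ (Dsym _ Hs)); unfold Cconj in E; simpl in E.
    rewrite Ropp_involutive in E; symmetry; exact E.
  - apply (is_derive_comp (fun s : R => conj_quatC (F (a, s))) Ropp).
    + rewrite Ropp_involutive.
      exact (is_derive_linear _ _ _ _ is_linear_conj_quatC Hb).
    + auto_derive; [exact I|ring]. }
unfold d_z; rewrite Ea, Eb, Ea', Eb'.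
destruct la as [[[[p1 p2] p3] p4] [[[p5 p6] p7] p8]].
destruct lb as [[[[q1 q2] q3] q4] [[[q5 q6] q7] q8]].
unfold conj_quatC, mul_sqrtm1, minus; simpl.
repeat (apply injective_projections); simpl;
  unfold minus, plus, opp, scal, mult; simpl;
  unfold plus, opp, scal, mult; simpl; unfold mult; simpl; ring.
Qed.

(* Main.v *)
(** For [c] in H let [phi c z] be the complex quadratic form of [F z - c], i.e.
    the sum of the squares of its four complex coordinates.  It is holomorphic
    in [z], and it vanishes at [alpha + i beta] if and only if [f] takes the
    value [c] somewhere on the sphere [alpha + S beta].  If [f] is injective,
    a zero [z] of [phi c] is therefore isolated.  Writing [phi c w = q w (w - z)^n],
    the mean of [q z (w - z)^n / phi c w] over a small circle around [z] is 1 as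
    soon as [q z <> 0], which bounds [|q z|] below as long as [phi c] stays away
    from 0 on that circle.  Hence, when [c] and [z] move along a path and [q z]
    is 0 initially, [q z] remains 0 for a while.

    Take [n = 1] at a nonreal [z0] where the slice derivative vanishes at
    [alpha + J beta].  Rotating [J] shows that all of [dF/dz (z0)] is 0;
    translating [z0] then shows that [dF/dz] is 0 on a horizontal segment.  At a
    real [z0], where zeros are double, take [n = 2].  In both cases [F] is
    constant on a segment, so that [f] is not injective. *)

Require Import Defs.
From Stdlib Require Import Reals Lra Classical IndefiniteDescription.
From Coquelicot Require Import Coquelicot.

(** * Complex differentiability *)

(** The argument is Hurwitz's: where the derivative degenerates, [phi c] has a zero of order greater
    than [n], and a small displacement of [c] and [z] that made the order exactly [n] would split
    off further zeros, against injectivity. Zeros are not counted. The complex analysis is reduced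
    to one fact: the mean of a holomorphic function over a circle does not depend on the radius,
    because by the Cauchy-Riemann equations its radial derivative is an angular derivative up to a
    factor. The displacement is what carries the information, for [q z = 0] is only one complex
    linear equation on dF/dz. At a nonreal point [q z] is twice the product of dF/dz with
    [F z - c = -J F2 + sqrt(-1) F2]. Here F2 is nonzero, since [f] is not constant on a sphere, so
    these vectors span H_C as [J] varies, and enough values of [J] force dF/dz = 0. At a real point
    F2 = 0, so that all four coordinates of [F - c] vanish and [q z] is the sum of the squares of
    the coordinates of dF/dz. These are real there, and positivity takes over the role of the
    rotations. *)

Lemma continuous_pair {T U V : UniformSpace} (f : T -> U) (g : T -> V) (x : T) :
  continuous f x -> continuous g x ->
  continuous (fun t => (f t, g t) : prod_UniformSpace U V) x.
Proof.
intros Hf Hg P [e He].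
destruct (Hf _ (locally_ball (f x) e)) as [d1 H1].
destruct (Hg _ (locally_ball (g x) e)) as [d2 H2].
exists (mkposreal _ (Rmin_stable_in_posreal d1 d2)); intros y Hy; apply He; split.
- apply H1; eapply ball_le; [apply Rmin_l|exact Hy].
- apply H2; eapply ball_le; [apply Rmin_r|exact Hy].
Qed.

Lemma continuous_C {T : UniformSpace} (f : T -> C) (x : T) :
  continuous f x <->
  continuous (fun t => Re (f t)) x /\ continuous (fun t => Im (f t)) x.
Proof.
split.
- intros H; split.
  + apply (continuous_comp f (fun z : C => Re z)); [exact H|apply continuous_fst].
  + apply (continuous_comp f (fun z : C => Im z)); [exact H|apply continuous_snd].
- intros [H1 H2].
  apply continuous_ext with (fun t => (Re (f t), Im (f t))).
  + intros t; symmetry; apply surjective_pairing.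
  + exact (continuous_pair _ _ _ H1 H2).
Qed.

Lemma continuous_Cmult {T : UniformSpace} (f g : T -> C) (x : T) :
  continuous f x -> continuous g x -> continuous (fun t => (f t * g t)%C) x.
Proof.
rewrite !continuous_C; intros [f1 f2] [g1 g2]; split; simpl.
- apply (continuous_minus (V := R_NormedModule)); apply (continuous_mult (K := R_AbsRing)); assumption.
- apply (continuous_plus (V := R_NormedModule)); apply (continuous_mult (K := R_AbsRing)); assumption.
Qed.

Lemma continuous_Cplus {T : UniformSpace} (f g : T -> C) (x : T) :
  continuous f x -> continuous g x -> continuous (fun t => (f t + g t)%C) x.
Proof.
rewrite !continuous_C; intros [f1 f2] [g1 g2]; split; simpl;
  apply (continuous_plus (V := R_NormedModule)); assumption.
Qed.

Lemma continuous_norm2 {T : UniformSpace} (u v : T -> R) (x : T) :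
  continuous u x -> continuous v x -> continuous (fun t => u t ^ 2 + v t ^ 2) x.
Proof.
intros Hu Hv; apply continuous_ext with (fun t => u t * u t + v t * v t).
{ intros t; simpl; rewrite !Rmult_1_r; reflexivity. }
apply (continuous_plus (V := R_NormedModule));
  apply (continuous_mult (K := R_AbsRing)); assumption.
Qed.

Lemma continuous_Cinv {T : UniformSpace} (f : T -> C) (x : T) :
  continuous f x -> f x <> 0 -> continuous (fun t => (/ f t)%C) x.
Proof.
rewrite !continuous_C; intros [f1 f2] Nz.
assert (N : Re (f x) ^ 2 + Im (f x) ^ 2 <> 0).
{ intros E; apply Nz; destruct (f x) as [a b]; simpl in E.
  assert (a = 0) by nra; assert (b = 0) by nra; subst; reflexivity. }
assert (Q : continuous (fun t => / (Re (f t) ^ 2 + Im (f t) ^ 2)) x).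
{ apply (continuous_comp (fun t => Re (f t) ^ 2 + Im (f t) ^ 2) Rinv);
    [|apply continuous_Rinv; exact N].
  apply continuous_norm2; assumption. }
split; simpl; apply (continuous_mult (K := R_AbsRing)); try assumption.
apply (continuous_opp (V := R_NormedModule)); assumption.
Qed.

Lemma continuous_Cmod {T : UniformSpace} (f : T -> C) (x : T) :
  continuous f x -> continuous (fun t => Cmod (f t)) x.
Proof.
rewrite continuous_C; intros [f1 f2].
apply (continuous_comp (fun t => Re (f t) ^ 2 + Im (f t) ^ 2) sqrt);
  [|apply continuous_sqrt].
apply continuous_norm2; assumption.
Qed.

(** Carathéodory's form, for which the rules of calculus are algebraic identities. *)
Definition is_Cderive (g : C -> C) (z d : C) : Prop :=
  exists q : C -> C, continuous q z /\ q z = d /\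
    locally z (fun w => g w = (g z + q w * (w - z))%C).

Lemma is_Cderive_continuous (g : C -> C) (z d : C) :
  is_Cderive g z d -> continuous g z.
Proof.
intros [q [Cq [_ Hq]]].
apply continuous_ext_loc with (fun w => (g z + q w * (w - z))%C).
- eapply filter_imp; [|exact Hq]; intros w Hw; symmetry; exact Hw.
- apply continuous_Cplus; [apply continuous_const|].
  apply continuous_Cmult; [exact Cq|].
  apply continuous_Cplus; [apply continuous_id|apply continuous_const].
Qed.

Lemma is_Cderive_ext_loc (g h : C -> C) (z d : C) :
  locally z (fun w => g w = h w) -> is_Cderive g z d -> is_Cderive h z d.
Proof.
intros E [q [Cq [Eq Hq]]]; exists q; repeat split; [exact Cq|exact Eq|].
rewrite <- (locally_singleton _ _ E).
eapply filter_imp; [|exact (filter_and _ _ E Hq)]; intros w [<- H]; exact H.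
Qed.

Lemma is_Cderive_const (c z : C) : is_Cderive (fun _ => c) z 0.
Proof.
exists (fun _ => 0); repeat split; [apply continuous_const|].
apply filter_forall; intros w; symmetry; ring.
Qed.

Lemma is_Cderive_id (z : C) : is_Cderive (fun w => w) z 1.
Proof.
exists (fun _ => 1); repeat split; [apply continuous_const|].
apply filter_forall; intros w; symmetry; ring.
Qed.

Lemma is_Cderive_plus (g h : C -> C) (z d e : C) :
  is_Cderive g z d -> is_Cderive h z e ->
  is_Cderive (fun w => (g w + h w)%C) z (d + e)%C.
Proof.
intros [q [Cq [<- Hq]]] [p [Cp [<- Hp]]]; exists (fun w => (q w + p w)%C).
repeat split; [apply continuous_Cplus; assumption|].
eapply filter_imp; [|exact (filter_and _ _ Hq Hp)]; intros w [E1 E2].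
rewrite E1, E2; ring.
Qed.

Lemma is_Cderive_mult (g h : C -> C) (z d e : C) :
  is_Cderive g z d -> is_Cderive h z e ->
  is_Cderive (fun w => (g w * h w)%C) z (d * h z + g z * e)%C.
Proof.
intros Hg [p [Cp [<- Hp]]]; pose proof (is_Cderive_continuous _ _ _ Hg) as Cg.
destruct Hg as [q [Cq [<- Hq]]].
exists (fun w => (q w * h z + g w * p w)%C).
repeat split.
- apply continuous_Cplus; apply continuous_Cmult; try assumption; apply continuous_const.
- eapply filter_imp; [|exact (filter_and _ _ Hq Hp)]; intros w [E1 E2].
  rewrite E2, E1; ring.
Qed.

Lemma continuous_neq0 {T : UniformSpace} (f : T -> C) (x : T) :
  continuous f x -> f x <> 0 -> locally x (fun t => f t <> 0).
Proof.
intros Cf Nz; apply continuous_Cmod in Cf.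
assert (P : 0 < Cmod (f x)) by (apply Cmod_gt_0; exact Nz).
assert (O : locally (Cmod (f x)) (fun r => 0 < r)) by (apply open_gt; exact P).
eapply filter_imp; [|exact (Cf _ O)]; intros t Ht; apply Cmod_gt_0; exact Ht.
Qed.

Lemma is_Cderive_inv (g : C -> C) (z d : C) :
  is_Cderive g z d -> g z <> 0 ->
  is_Cderive (fun w => (/ g w)%C) z (- d / (g z * g z))%C.
Proof.
intros Hg Nz; pose proof (is_Cderive_continuous _ _ _ Hg) as Cg.
destruct Hg as [q [Cq [<- Hq]]].
exists (fun w => (- 1 * q w * / (g w * g z))%C); repeat split.
- apply continuous_Cmult; [apply continuous_Cmult; [apply continuous_const|exact Cq]|].
  apply continuous_Cinv.
  + apply continuous_Cmult; [exact Cg|apply continuous_const].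
  + apply Cmult_neq_0; exact Nz.
- field; exact Nz.
- eapply filter_imp; [|exact (filter_and _ _ Hq (continuous_neq0 _ _ Cg Nz))].
  intros w [E1 Nw].
  assert (E : (q w * (w - z) = g w - g z)%C) by (rewrite E1; ring).
  transitivity (/ g z + - 1 * (q w * (w - z)) * / (g w * g z))%C; [|ring].
  rewrite E; field; split; assumption.
Qed.

(** Continuity of [g'] is built in because the means over circles are differentiated under the
    integral sign. *)
Definition C1_Cderive (g g' : C -> C) (z : C) : Prop :=
  continuous g' z /\ locally z (fun w => is_Cderive g w (g' w)).

Lemma C1_Cderive_is_Cderive (g g' : C -> C) (z : C) :
  C1_Cderive g g' z -> is_Cderive g z (g' z).
Proof. intros [_ H]; exact (locally_singleton _ _ H). Qed.

Lemma C1_Cderive_ext_loc (g h g' : C -> C) (z : C) :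
  locally z (fun w => g w = h w) -> C1_Cderive g g' z -> C1_Cderive h g' z.
Proof.
intros E [Cg Hg]; split; [exact Cg|].
apply locally_locally in E.
eapply filter_imp; [|exact (filter_and _ _ E Hg)]; intros w [Ew Dw].
exact (is_Cderive_ext_loc _ _ _ _ Ew Dw).
Qed.

Lemma C1_Cderive_ext (g g' h' : C -> C) (z : C) :
  (forall w, g' w = h' w) -> C1_Cderive g g' z -> C1_Cderive g h' z.
Proof.
intros E [Cg Hg]; split; [exact (continuous_ext _ _ _ E Cg)|].
eapply filter_imp; [|exact Hg]; intros w Hw; cbv beta; rewrite <- E; exact Hw.
Qed.

Lemma C1_Cderive_const (c z : C) : C1_Cderive (fun _ => c) (fun _ => 0) z.
Proof.
split; [apply continuous_const|].
apply filter_forall; intros w; apply is_Cderive_const.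
Qed.

Lemma C1_Cderive_id (z : C) : C1_Cderive (fun w => w) (fun _ => 1) z.
Proof.
split; [apply continuous_const|].
apply filter_forall; intros w; apply is_Cderive_id.
Qed.

Lemma C1_Cderive_plus (g g' h h' : C -> C) (z : C) :
  C1_Cderive g g' z -> C1_Cderive h h' z ->
  C1_Cderive (fun w => (g w + h w)%C) (fun w => (g' w + h' w)%C) z.
Proof.
intros [Cg Hg] [Ch Hh]; split; [apply continuous_Cplus; assumption|].
eapply filter_imp; [|exact (filter_and _ _ Hg Hh)]; intros w [A B].
apply is_Cderive_plus; assumption.
Qed.

Lemma C1_Cderive_mult (g g' h h' : C -> C) (z : C) :
  C1_Cderive g g' z -> C1_Cderive h h' z ->
  C1_Cderive (fun w => (g w * h w)%C) (fun w => (g' w * h w + g w * h' w)%C) z.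
Proof.
intros [Cg Hg] [Ch Hh].
pose proof (is_Cderive_continuous _ _ _ (locally_singleton _ _ Hg)).
pose proof (is_Cderive_continuous _ _ _ (locally_singleton _ _ Hh)).
split; [apply continuous_Cplus; apply continuous_Cmult; assumption|].
eapply filter_imp; [|exact (filter_and _ _ Hg Hh)]; intros w [A B].
apply is_Cderive_mult; assumption.
Qed.

Lemma C1_Cderive_inv (g g' : C -> C) (z : C) :
  C1_Cderive g g' z -> g z <> 0 ->
  C1_Cderive (fun w => (/ g w)%C) (fun w => (- g' w / (g w * g w))%C) z.
Proof.
intros [Cg Hg] Nz.
pose proof (is_Cderive_continuous _ _ _ (locally_singleton _ _ Hg)) as Cz.
split.
- apply continuous_ext with (fun w => (- 1 * g' w * / (g w * g w))%C).
  { intros w; unfold Cdiv; f_equal; ring. }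
  apply continuous_Cmult.
  + apply continuous_Cmult; [apply continuous_const|exact Cg].
  + apply continuous_Cinv; [apply continuous_Cmult; exact Cz|].
    apply Cmult_neq_0; exact Nz.
- eapply filter_imp; [|exact (filter_and _ _ Hg (continuous_neq0 _ _ Cz Nz))].
  intros w [A B]; apply is_Cderive_inv; assumption.
Qed.

Lemma is_derive_eq (f : R -> R) (t d e : R) :
  is_derive f t d -> d = e -> is_derive f t e.
Proof. intros H <-; exact H. Qed.

(** The quotient in Carathéodory's form is only continuous, so the product rule does not apply to
    it. As [m] vanishes at [t], the difference quotient of the product is [p (t + h)] times that of
    [m], and continuity of [p] is enough. *)
Lemma is_derive_mult_root (p m : R -> R) (t d : R) :
  continuous p t -> is_derive m t d -> m t = 0 ->
  is_derive (fun s => p s * m s) t (p t * d).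
Proof.
intros Cp Hm Z; apply is_derive_Reals in Hm; apply is_derive_Reals.
intros e He.
set (M := Rabs (p t) + 1).
assert (HM : 0 < M) by (unfold M; pose proof (Rabs_pos (p t)); lra).
set (e1 := Rmin 1 (e / 2 / (Rabs d + 1))).
assert (Hd : 0 < Rabs d + 1) by (pose proof (Rabs_pos d); lra).
assert (He1 : 0 < e1).
{ apply Rmin_pos; [lra|]; apply Rdiv_lt_0_compat; lra. }
destruct (proj1 (filterlim_locally _ _) Cp (mkposreal _ He1)) as [d1 H1].
assert (He2 : 0 < e / 2 / M) by (apply Rdiv_lt_0_compat; lra).
destruct (Hm _ He2) as [d2 H2].
exists (mkposreal _ (Rmin_stable_in_posreal d1 d2)); intros h Nh Hh; simpl in Hh.
assert (B1 : Rabs (p (t + h) - p t) < e1).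
{ apply (H1 (t + h)); change (Rabs (t + h - t) < d1).
  replace (t + h - t) with h by ring.
  eapply Rlt_le_trans; [exact Hh|apply Rmin_l]. }
assert (B2 : Rabs ((m (t + h) - m t) / h - d) < e / 2 / M).
{ apply H2; [exact Nh|eapply Rlt_le_trans; [exact Hh|apply Rmin_r]]. }
rewrite Z in *.
replace ((p (t + h) * m (t + h) - p t * 0) / h - p t * d)
  with (p (t + h) * ((m (t + h) - 0) / h - d) + (p (t + h) - p t) * d)
  by (field; exact Nh).
eapply Rle_lt_trans; [apply Rabs_triang|]; rewrite !Rabs_mult.
assert (B3 : Rabs (p (t + h)) < M).
{ replace (p (t + h)) with (p t + (p (t + h) - p t)) by ring.
  eapply Rle_lt_trans; [apply Rabs_triang|]; unfold M.
  assert (e1 <= 1) by apply Rmin_l; lra. }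
assert (A1 : Rabs (p (t + h)) * Rabs ((m (t + h) - 0) / h - d) < e / 2).
{ apply Rle_lt_trans with (M * Rabs ((m (t + h) - 0) / h - d)).
  - apply Rmult_le_compat_r; [apply Rabs_pos|lra].
  - apply Rlt_le_trans with (M * (e / 2 / M));
    [apply Rmult_lt_compat_l; assumption|right; field; lra]. }
assert (A2 : Rabs (p (t + h) - p t) * Rabs d <= e / 2).
{ apply Rle_trans with (e / 2 / (Rabs d + 1) * (Rabs d + 1)).
  - apply Rmult_le_compat; try apply Rabs_pos; [|lra].
    assert (e1 <= e / 2 / (Rabs d + 1)) by apply Rmin_r; lra.
  - right; field; lra. }
lra.
Qed.

Lemma is_Cderive_curve (g : C -> C) (d : C) (x y : R -> R) (t dx dy : R) :
  is_Cderive g (x t, y t) d -> is_derive x t dx -> is_derive y t dy ->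
  is_derive (fun s => Re (g (x s, y s))) t (Re (d * (dx, dy))) /\
  is_derive (fun s => Im (g (x s, y s))) t (Im (d * (dx, dy))).
Proof.
intros [q [Cq [<- Hq]]] Hx Hy.
assert (Cc : continuous (fun s => (x s, y s) : C) t).
{ apply continuous_pair; apply (ex_derive_continuous (V := R_NormedModule));
    eexists; eassumption. }
specialize (Cc _ Hq).
assert (Cqc : continuous (fun s => q (x s, y s)) t).
{ apply (continuous_comp (fun s => (x s, y s) : C) q); [|exact Cq].
  apply continuous_pair; apply (ex_derive_continuous (V := R_NormedModule));
    eexists; eassumption. }
apply continuous_C in Cqc; destruct Cqc as [C1 C2].
assert (Hx' : is_derive (fun s => x s - x t) t dx).
{ replace dx with (minus dx 0) by (unfold minus, plus, opp; simpl; ring).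
  apply (is_derive_minus (V := R_NormedModule)); [exact Hx|].
  apply (is_derive_const (V := R_NormedModule)). }
assert (Hy' : is_derive (fun s => y s - y t) t dy).
{ replace dy with (minus dy 0) by (unfold minus, plus, opp; simpl; ring).
  apply (is_derive_minus (V := R_NormedModule)); [exact Hy|].
  apply (is_derive_const (V := R_NormedModule)). }
pose proof (is_derive_mult_root _ _ _ _ C1 Hx' (Rminus_diag _)) as A1.
pose proof (is_derive_mult_root _ _ _ _ C2 Hx' (Rminus_diag _)) as A2.
pose proof (is_derive_mult_root _ _ _ _ C1 Hy' (Rminus_diag _)) as A3.
pose proof (is_derive_mult_root _ _ _ _ C2 Hy' (Rminus_diag _)) as A4.
split.
- apply is_derive_ext_loc with (fun s => Re (g (x t, y t)) +
    (Re (q (x s, y s)) * (x s - x t) - Im (q (x s, y s)) * (y s - y t))).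
  { eapply filter_imp; [|exact Cc]; intros s Hs; cbv beta in Hs; rewrite Hs; simpl.
    unfold Re, Im; ring. }
  eapply is_derive_eq; [apply (is_derive_plus (V := R_NormedModule));
    [apply (is_derive_const (V := R_NormedModule))|
     apply (is_derive_minus (V := R_NormedModule)); eassumption]|].
  unfold plus, minus, zero, plus, opp, Re, Im; simpl; unfold Re, Im; ring.
- apply is_derive_ext_loc with (fun s => Im (g (x t, y t)) +
    (Re (q (x s, y s)) * (y s - y t) + Im (q (x s, y s)) * (x s - x t))).
  { eapply filter_imp; [|exact Cc]; intros s Hs; cbv beta in Hs; rewrite Hs; simpl.
    unfold Re, Im; ring. }
  eapply is_derive_eq; [apply (is_derive_plus (V := R_NormedModule));
    [apply (is_derive_const (V := R_NormedModule))|
     apply (is_derive_plus (V := R_NormedModule)); eassumption]|].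
  unfold plus, minus, zero, plus, opp, Re, Im; simpl; unfold Re, Im; ring.
Qed.

(** * Mean values on circles *)

Definition circle_pt (z : C) (r t : R) : C := (Re z + r * cos t, Im z + r * sin t).

Lemma circle_pt_minus (z : C) (r t : R) :
  (circle_pt z r t - z = r * (cos t, sin t))%C.
Proof.
destruct z; apply injective_projections; simpl; ring.
Qed.

Lemma Cmod_circle_pt (z : C) (r t : R) : 0 <= r -> Cmod (circle_pt z r t - z) = r.
Proof.
intros Hr; rewrite circle_pt_minus, Cmod_mult, Cmod_R, Rabs_pos_eq by exact Hr.
unfold Cmod; cbn [fst snd].
replace (cos t ^ 2 + sin t ^ 2) with 1
  by (rewrite <- (sin2_cos2 t); unfold Rsqr; ring).
rewrite sqrt_1; ring.
Qed.

Lemma continuous_circle_pt {T : UniformSpace} (z : T -> C) (r t : T -> R) (x : T) :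
  continuous z x -> continuous r x -> continuous t x ->
  continuous (fun u => circle_pt (z u) (r u) (t u)) x.
Proof.
intros Hz Hr Ht; apply continuous_C in Hz; destruct Hz as [H1 H2].
apply continuous_pair; apply (continuous_plus (V := R_NormedModule)); try assumption;
  apply (continuous_mult (K := R_AbsRing)); try assumption.
- apply (continuous_comp t cos); [exact Ht|apply continuous_cos].
- apply (continuous_comp t sin); [exact Ht|apply continuous_sin].
Qed.

Lemma is_derive_radial (g : C -> C) (z d : C) (r t : R) :
  is_Cderive g (circle_pt z r t) d ->
  is_derive (fun s => Re (g (circle_pt z s t))) r (Re (d * (cos t, sin t))).
Proof.
intros H; refine (proj1 (is_Cderive_curve g d (fun s => Re z + s * cos t)
  (fun s => Im z + s * sin t) r (cos t) (sin t) H _ _)); auto_derive; auto; ring.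
Qed.

(** Cauchy-Riemann in polar coordinates: the angular velocity is [i r] times the radial one, and the
    imaginary part of [i u] is the real part of [u]. Up to the factor [r] this is the derivative in
    [is_derive_radial]. *)
Lemma is_derive_angular (g : C -> C) (z d : C) (r t : R) :
  is_Cderive g (circle_pt z r t) d ->
  is_derive (fun s => Im (g (circle_pt z r s))) t (r * Re (d * (cos t, sin t))).
Proof.
intros H; eapply is_derive_eq.
- refine (proj2 (is_Cderive_curve g d (fun s => Re z + r * cos s)
    (fun s => Im z + r * sin s) t (- (r * sin t)) (r * cos t) H _ _));
    auto_derive; auto; ring.
- destruct d; simpl; ring.
Qed.

Section CircleMean.

Variables (g g' : C -> C) (z : C) (b : R).
Hypothesis g_center : continuous g z.
Hypothesis g_punctured : forall w, 0 < Cmod (w - z) < b -> C1_Cderive g g' w.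

Let M (r : R) : R := RInt (fun t => Re (g (circle_pt z r t))) 0 (2 * PI).

Let on_circle (r t : R) : 0 < r < b -> C1_Cderive g g' (circle_pt z r t).
Proof. intros Hr; apply g_punctured; rewrite Cmod_circle_pt; lra. Qed.

Let radial_continuous (r t : R) : 0 < r < b ->
  continuous (fun u : R * R => Re (g' (circle_pt z (fst u) (snd u)) *
    (cos (snd u), sin (snd u)))) (r, t).
Proof.
intros Hr.
apply (continuous_comp (fun u : R * R => (g' (circle_pt z (fst u) (snd u)) *
    (cos (snd u), sin (snd u)))%C) (fun c : C => Re c)); [|apply continuous_fst].
apply continuous_Cmult.
- apply (continuous_comp (fun u : R * R => circle_pt z (fst u) (snd u)) g').
  + apply continuous_circle_pt; [apply continuous_const|apply continuous_fst|
      apply continuous_snd].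
  + exact (proj1 (on_circle r t Hr)).
- apply continuous_pair.
  + apply (continuous_comp snd cos); [apply continuous_snd|apply continuous_cos].
  + apply (continuous_comp snd sin); [apply continuous_snd|apply continuous_sin].
Qed.

(** Times [r], the integrand is the derivative in [t] of the imaginary part of [g] on the circle,
    which takes the same value at both ends of a full turn. *)
Let radial_integral (r : R) : 0 < r < b ->
  RInt (fun t => Re (g' (circle_pt z r t) * (cos t, sin t))) 0 (2 * PI) = 0.
Proof.
intros Hr.
assert (H : is_RInt (fun t => r * Re (g' (circle_pt z r t) * (cos t, sin t)))
              0 (2 * PI) (minus (Im (g (circle_pt z r (2 * PI))))
                                (Im (g (circle_pt z r 0))))).
{ apply (is_RInt_derive (V := R_CompleteNormedModule)
    (fun t => Im (g (circle_pt z r t)))).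
  - intros t _; apply is_derive_angular.
    exact (C1_Cderive_is_Cderive _ _ _ (on_circle r t Hr)).
  - intros t _; apply (continuous_mult (K := R_AbsRing)); [apply continuous_const|].
    apply (continuous_comp_2 (fun _ : R => r) (fun s => s)
      (fun r t => Re (g' (circle_pt z r t) * (cos t, sin t))));
      [apply continuous_const|apply continuous_id|exact (radial_continuous r t Hr)]. }
unfold circle_pt in H at 2 3.
rewrite cos_2PI, sin_2PI, cos_0, sin_0, minus_eq_zero in H.
apply (is_RInt_scal _ _ _ (/ r)) in H; rewrite (scal_zero_r (V := R_NormedModule)) in H.
apply is_RInt_unique; eapply is_RInt_ext; [|exact H].
intros t _; unfold scal; simpl; unfold mult; simpl; field; lra.
Qed.

Let near_radius (r : R) : 0 < r < b -> locally r (fun s => 0 < s < b).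
Proof.
intros Hr; apply (locally_interval _ r 0 b); simpl; tauto.
Qed.

Let ex_M (r : R) : 0 < r < b ->
  ex_RInt (fun t => Re (g (circle_pt z r t))) 0 (2 * PI).
Proof.
intros Hr; apply (ex_RInt_continuous (V := R_CompleteNormedModule)); intros t _.
apply (continuous_comp (fun t => g (circle_pt z r t)) (fun c : C => Re c));
  [|apply continuous_fst].
apply (continuous_comp (fun t => circle_pt z r t) g).
- apply continuous_circle_pt; try apply continuous_const; apply continuous_id.
- eapply is_Cderive_continuous, C1_Cderive_is_Cderive, on_circle, Hr.
Qed.

Let derive_M (r : R) : 0 < r < b -> is_derive M r 0.
Proof.
intros Hr.
assert (D : forall s t, 0 < s < b ->
  is_derive (fun u => Re (g (circle_pt z u t))) s
    (Re (g' (circle_pt z s t) * (cos t, sin t)))).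
{ intros s t Hs; apply is_derive_radial.
  exact (C1_Cderive_is_Cderive _ _ _ (on_circle s t Hs)). }
rewrite <- (radial_integral r Hr).
rewrite <- (RInt_ext (fun t => Derive (fun u => Re (g (circle_pt z u t))) r)).
- apply (is_derive_RInt_param (fun u t => Re (g (circle_pt z u t))) 0 (2 * PI) r).
  + eapply filter_imp; [|exact (near_radius r Hr)]; intros s Hs t _.
    eexists; exact (D s t Hs).
  + intros t _.
    apply continuity_2d_pt_ext_loc with
      (fun u v => Re (g' (circle_pt z u v) * (cos v, sin v))).
    * destruct (near_radius r Hr) as [e He]; exists e; intros u v Hu _.
      symmetry; apply is_derive_unique, D, He; exact Hu.
    * apply continuity_2d_pt_filterlim; exact (radial_continuous r t Hr).
  + eapply filter_imp; [|exact (near_radius r Hr)]; exact ex_M.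
- intros t _; apply is_derive_unique, D, Hr.
Qed.

(** [M] has derivative 0 on the open interval from 0 to [b], and continuity at the centre identifies
    its limit at 0. Nothing more is asked at the centre because the lemma serves for [q z / q],
    where [q] is known to be continuous at [z] but holomorphic only away from it. *)
Lemma circle_mean (r : R) : 0 < r < b -> M r = 2 * PI * Re (g z).
Proof.
intros Hr.
assert (HPI := PI_RGT_0).
assert (B : forall e, 0 < e -> Rabs (M r - 2 * PI * Re (g z)) <= 2 * PI * e).
{ intros e He.
  pose proof (proj1 (proj1 (continuous_C _ _) g_center)) as Cg.
  destruct (proj1 (filterlim_locally _ _) Cg (mkposreal e He)) as [d Hd].
  set (s := Rmin (r / 2) (d / 2)).
  assert (Hd' := cond_pos d).
  assert (Hs : 0 < s) by (apply Rmin_pos; lra).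
  assert (Hsr : s <= r / 2) by apply Rmin_l.
  assert (Hsd : s <= d / 2) by apply Rmin_r.
  assert (E : M s = M r).
  { apply (eq_is_derive (V := R_NormedModule) M); [|lra].
    intros t Ht; apply derive_M; lra. }
  assert (P : forall t, Rabs (Re (g (circle_pt z s t)) - Re (g z)) <= e).
  { intros t; left; apply (Hd (circle_pt z s t)).
    assert (Q := Cmod_circle_pt z s t (Rlt_le _ _ Hs)).
    assert (Q2 := Rmax_Cmod (circle_pt z s t - z)%C); rewrite Q in Q2.
    split; [change (Rabs (fst (circle_pt z s t - z)%C) < d)|
            change (Rabs (snd (circle_pt z s t - z)%C) < d)];
      (eapply Rle_lt_trans; [|apply Rle_lt_trans with (1 := Q2); lra]);
      [apply Rmax_l|apply Rmax_r]. }
  assert (Cst : forall c, RInt (fun _ => c) 0 (2 * PI) = 2 * PI * c).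
  { intros c; rewrite RInt_const; unfold scal; simpl; unfold mult; simpl; ring. }
  rewrite <- E; apply Rabs_le; split.
  - assert (RInt (fun _ => Re (g z) - e) 0 (2 * PI) <= M s).
    { apply RInt_le; [lra|apply ex_RInt_const|apply ex_M; lra|].
      intros t _; assert (Q := P t); apply Rabs_le_between in Q; lra. }
    rewrite Cst in H; lra.
  - assert (M s <= RInt (fun _ => Re (g z) + e) 0 (2 * PI)).
    { apply RInt_le; [lra|apply ex_M; lra|apply ex_RInt_const|].
      intros t _; assert (Q := P t); apply Rabs_le_between in Q; lra. }
    rewrite Cst in H; lra. }
apply Rminus_diag_uniq; apply NNPP; intros N.
assert (Pos := Rabs_pos_lt _ N).
set (a := Rabs (M r - 2 * PI * Re (g z))) in *.
assert (Q := B (a / (4 * PI)) ltac:(apply Rdiv_lt_0_compat; lra)).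
replace (2 * PI * (a / (4 * PI))) with (a / 2) in Q by (field; lra).
lra.
Qed.

(** The factor 2 leaves slack: were the real part below half its central value all along the circle,
    the weak monotonicity of the integral would already contradict the mean value. *)
Lemma circle_mean_half (r : R) : 0 < r < b -> 0 < Re (g z) ->
  exists t, 0 <= t <= 2 * PI /\ Re (g z) <= 2 * Re (g (circle_pt z r t)).
Proof.
intros Hr Pos; apply NNPP; intros N.
assert (HPI := PI_RGT_0).
assert (Q : M r <= RInt (fun _ => Re (g z) / 2) 0 (2 * PI)).
{ apply RInt_le; [lra|apply ex_M; lra|apply ex_RInt_const|].
  intros t Ht; destruct (Rle_lt_dec (Re (g z)) (2 * Re (g (circle_pt z r t)))); [|lra].
  exfalso; apply N; exists t; split; lra. }
rewrite (circle_mean r Hr), RInt_const in Q.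
unfold scal in Q; simpl in Q; unfold mult in Q; simpl in Q.
assert (0 < PI * Re (g z)) by (apply Rmult_lt_0_compat; assumption); lra.
Qed.

End CircleMean.

(** The formula for the derivative never matters. What matters is that one function [d] serves at
    all points [z], as the punctured disc requires. *)
Lemma ex_C1_Cderive_pow (g g' : C -> C) (n : nat) :
  exists d : C -> C, forall z, C1_Cderive g g' z ->
    C1_Cderive (fun w => (g w ^ n)%C) d z.
Proof.
induction n as [|n [d IH]]; eexists; intros z Hg.
- exact (C1_Cderive_const 1 z).
- exact (C1_Cderive_mult _ _ _ _ _ Hg (IH z Hg)).
Qed.

Lemma Cminus_neq_0 (z w : C) : w <> z -> (w - z)%C <> 0.
Proof.
intros N E; apply N; replace w with (w - z + z)%C by ring; rewrite E; ring.
Qed.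

Lemma locally_neq (z w : C) : w <> z -> locally w (fun u : C => u <> z).
Proof.
intros N.
eapply filter_imp; [|apply (continuous_neq0 (fun u : C => (u - z)%C) w)].
- intros u Hu E; apply Hu; cbv beta; rewrite E; ring.
- apply continuous_Cplus; [apply continuous_id|apply continuous_const].
- apply Cminus_neq_0, N.
Qed.

Lemma circle_small_value (phi phi' q : C -> C) (z : C) (n : nat) (b r : R) :
  (forall w, phi w = (q w * (w - z) ^ n)%C) ->
  (forall w, 0 < Cmod (w - z) < b -> phi w <> 0 /\ C1_Cderive phi phi' w) ->
  continuous q z -> q z <> 0 -> 0 < r < b ->
  exists t, 0 <= t <= 2 * PI /\
    Cmod (phi (circle_pt z r t)) <= 2 * r ^ n * Cmod (q z).
Proof.
intros Eq Hphi Cq Nq Hr.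
set (g := fun w => (q z * / q w)%C).
assert (Gz : g z = 1) by (unfold g; field; exact Nq).
destruct (ex_C1_Cderive_pow (fun w => w - z)%C (fun w => 1 + 0)%C n) as [d Hd].
destruct (circle_mean_half g
  (fun w => (0 * ((w - z) ^ n * / phi w) +
     q z * (d w * / phi w + (w - z) ^ n * (- phi' w / (phi w * phi w))))%C)
   z b) with (r := r) as [t [Ht H]].
- apply continuous_Cmult; [apply continuous_const|apply continuous_Cinv; assumption].
- intros w Hw; destruct (Hphi w Hw) as [Nw Dw].
  assert (Nz : w <> z).
  { intros ->; replace (z - z)%C with (RtoC 0) in Hw by ring.
    rewrite Cmod_0 in Hw; lra. }
  (* Away from [z] the quotient [q] inherits its regularity from [phi] through
     [q w = phi w / (w - z)^n]; it has no zero there because [phi] has none. *)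
  apply C1_Cderive_ext_loc with (fun w => (q z * ((w - z) ^ n * / phi w))%C).
  + eapply filter_imp; [|exact (filter_and _ _ (locally_neq z w Nz)
      (continuous_neq0 _ _ (is_Cderive_continuous _ _ _
         (C1_Cderive_is_Cderive _ _ _ Dw)) Nw))].
    intros u [Nu Pu]; unfold g; rewrite Eq in Pu |- *.
    assert ((u - z) ^ n <> 0)%C by (intros E; apply Pu; rewrite E; ring).
    assert (q u <> 0) by (intros E; apply Pu; rewrite E; ring).
    field; split; assumption.
  + apply (C1_Cderive_mult (fun _ => q z) (fun _ => 0)); [apply C1_Cderive_const|].
    apply (C1_Cderive_mult (fun w => (w - z) ^ n)%C); [|apply C1_Cderive_inv; assumption].
    apply Hd, (C1_Cderive_plus (fun w => w)); [apply C1_Cderive_id|apply C1_Cderive_const].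
- exact Hr.
- rewrite Gz; simpl; lra.
- exists t; split; [exact Ht|].
  rewrite Gz in H; change (Re 1) with 1 in H.
  assert (Q : Cmod (circle_pt z r t - z) = r) by (apply Cmod_circle_pt; lra).
  destruct (Hphi (circle_pt z r t)) as [N _]; [rewrite Q; exact Hr|].
  assert (Eg : (g (circle_pt z r t) * phi (circle_pt z r t) =
                q z * (circle_pt z r t - z) ^ n)%C).
  { unfold g; rewrite Eq in N |- *; field; intros E; apply N; rewrite E; ring. }
  apply (f_equal Cmod) in Eg; rewrite !Cmod_mult, Cmod_pow, Q in Eg.
  assert (A := re_le_Cmod (g (circle_pt z r t))).
  assert (A' := Rle_abs (Re (g (circle_pt z r t)))).
  assert (P := Cmod_ge_0 (phi (circle_pt z r t))).
  replace (2 * r ^ n * Cmod (q z)) with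
    (2 * Cmod (g (circle_pt z r t)) * Cmod (phi (circle_pt z r t)))
    by (rewrite Rmult_assoc, Eg; ring).
  rewrite <- (Rmult_1_l (Cmod (phi _))) at 1.
  apply Rmult_le_compat_r; [exact P|lra].
Qed.

(** * Zeros of a family depending on a real parameter *)

Lemma tube (P : R * R -> Prop) (a b : R) :
  (forall t, a <= t <= b -> locally (0, t) P) ->
  exists d : posreal, forall s t, Rabs s < d -> a <= t <= b -> P (s, t).
Proof.
intros H.
assert (H' : forall t, exists e : posreal, a <= t <= b ->
  forall s u, Rabs s < e -> Rabs (u - t) < e -> P (s, u)).
{ intros t; destruct (classic (a <= t <= b)) as [Ht|Ht].
  - destruct (H t Ht) as [e He]; exists e; intros _ s u Hs Hu; apply He.
    split; [|exact Hu]; change (Rabs (s - 0) < e); rewrite Rminus_0_r; exact Hs.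
  - exists (mkposreal 1 Rlt_0_1); intros; contradiction. }
apply functional_choice in H'; destruct H' as [e He].
destruct (compactness_value_1d a b e) as [d Hd]; exists d; intros s t Hs Ht.
(* [compactness_value_1d] provides its centre [x] only under a double negation, hence the argument
   by contradiction. *)
apply NNPP; intros N; apply (Hd t Ht); intros [x [Hx [Hxt Hdx]]]; apply N.
apply (He x Hx); [lra|exact Hxt].
Qed.

(** The essential point is that [b] does not depend on [s]: it forbids other zeros from splitting
    off [z s]. On the circle of radius [r], the strict inequality between [2 r^n |l s|] and
    [|Phi s|] holds at [s = 0], where the left side is 0, and persists for small [s] by compactness;
    [circle_small_value] contradicts it unless [l s = 0]. *)
Lemma vanishing_leading_coeff (Phi dPhi : R -> C -> C) (z l : R -> C) (n : nat)
    (b r : R) (eta : posreal) :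
  0 < r < b ->
  (forall s, Rabs s < eta -> exists q : C -> C,
     continuous q (z s) /\ q (z s) = l s /\
     forall w, Phi s w = (q w * (w - z s) ^ n)%C) ->
  (forall s w, Rabs s < eta -> 0 < Cmod (w - z s) < b ->
     Phi s w <> 0 /\ C1_Cderive (Phi s) (dPhi s) w) ->
  (forall t, continuous (fun u : R * R =>
     Phi (fst u) (circle_pt (z (fst u)) r (snd u))) (0, t)) ->
  continuous l 0 -> l 0 = 0 ->
  exists d : posreal, forall s, Rabs s < d -> l s = 0.
Proof.
intros Hr Hq HPhi CPhi Cl l0.
destruct (tube (fun u => 2 * r ^ n * Cmod (l (fst u)) <
    Cmod (Phi (fst u) (circle_pt (z (fst u)) r (snd u)))) 0 (2 * PI)) as [d Hd].
- intros t _.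
  assert (C2 : continuous (fun u : R * R => minus (Cmod (Phi (fst u)
      (circle_pt (z (fst u)) r (snd u)))) (2 * r ^ n * Cmod (l (fst u)))) (0, t)).
  { apply (continuous_minus (V := R_NormedModule)).
    - apply continuous_Cmod, CPhi.
    - apply (continuous_mult (K := R_AbsRing)); [apply continuous_const|].
      apply continuous_Cmod, (continuous_comp fst l); [apply continuous_fst|exact Cl]. }
  assert (Z : 0 < minus (Cmod (Phi 0 (circle_pt (z 0) r t))) (2 * r ^ n * Cmod (l 0))).
  { rewrite l0, Cmod_0, Rmult_0_r; unfold minus, plus, opp; simpl.
    rewrite Ropp_0, Rplus_0_r; apply Cmod_gt_0.
    apply (HPhi 0); [rewrite Rabs_R0; apply cond_pos|].
    rewrite Cmod_circle_pt; lra. }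
  eapply filter_imp; [|exact (C2 _ (open_gt 0 _ Z))].
  intros u Hu; unfold minus, plus, opp in Hu; simpl in Hu; lra.
- exists (mkposreal _ (Rmin_stable_in_posreal d eta)); intros s Hs; simpl in Hs.
  assert (H1 : Rabs s < d) by (eapply Rlt_le_trans; [exact Hs|apply Rmin_l]).
  assert (H2 : Rabs s < eta) by (eapply Rlt_le_trans; [exact Hs|apply Rmin_r]).
  apply NNPP; intros N.
  destruct (Hq s H2) as [q [Cq [Eq Hq']]]; rewrite <- Eq in N.
  destruct (circle_small_value (Phi s) (dPhi s) q (z s) n b r) as [t [Ht Q]];
    try assumption; [intros w; exact (HPhi s w H2)|].
  specialize (Hd s t H1 Ht); simpl in Hd; rewrite <- Eq in Hd; lra.
Qed.

(** * Complexified quaternions *)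

(** Carathéodory's quotient made canonical: with the value [d] at [z], the factorization of
    [g w - g z] holds for all [w] and not just near [z]. *)
Definition slope (g : C -> C) (z d w : C) : C :=
  if Ceq_dec w z then d else ((g w - g z) / (w - z))%C.

Lemma slope_diag (g : C -> C) (z d : C) : slope g z d z = d.
Proof. unfold slope; destruct (Ceq_dec z z) as [_|N]; [reflexivity|now elim N]. Qed.

Lemma slopeE (g : C -> C) (z d w : C) : g w = (g z + slope g z d w * (w - z))%C.
Proof.
unfold slope; destruct (Ceq_dec w z) as [->|N]; [ring|].
field; apply Cminus_neq_0, N.
Qed.

Lemma slope_affine (a q z w : C) :
  w <> z -> ((a + q * (w - z) - a) / (w - z))%C = q.
Proof. intros N; field; apply Cminus_neq_0, N. Qed.

Lemma continuous_slope (g : C -> C) (z d : C) :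
  is_Cderive g z d -> continuous (slope g z d) z.
Proof.
intros [q [Cq [<- Hq]]].
apply continuous_ext_loc with q; [|exact Cq].
eapply filter_imp; [|exact Hq]; intros w Hw; symmetry.
unfold slope; destruct (Ceq_dec w z) as [->|N]; [reflexivity|].
rewrite Hw; exact (slope_affine (g z) (q w) z w N).
Qed.

Lemma filterdiff_le (f : R -> R -> R) (x y lx ly : R) (e : posreal) :
  filterdiff (fun u : R * R => f (fst u) (snd u)) (locally (x, y))
    (fun u => plus (scal (fst u) lx) (scal (snd u) ly)) ->
  locally (x, y) (fun w : C => Rabs (f (Re w) (Im w) - f x y -
     ((Re w - x) * lx + (Im w - y) * ly)) <= e * Cmod (w - (x, y))).
Proof.
intros [_ H]; specialize (H (x, y) (fun P HP => HP) e).
eapply filter_imp; [|exact H]; intros [a b] Hw.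
replace (Cmod ((a, b) - (x, y))) with (norm (minus (a, b) (x, y) : R * R)).
- exact Hw.
- change (sqrt (Rabs (a - x) ^ 2 + Rabs (b - y) ^ 2) = Cmod ((a, b) - (x, y))).
  rewrite !pow2_abs; reflexivity.
Qed.

(** The Cauchy-Riemann equations with one continuous partial derivative. The asymmetry is that of
    the usual proof of differentiability: the mean value theorem is applied along horizontal
    segments close to [z], whereas the vertical derivative enters at [z] alone. *)
Lemma is_Cderive_partials (g a : C -> C) (z : C) :
  locally z (fun w =>
    is_derive (fun s => Re (g (s, Im w))) (Re w) (Re (a w)) /\
    is_derive (fun s => Im (g (s, Im w))) (Re w) (Im (a w))) ->
  is_derive (fun s => Re (g (Re z, s))) (Im z) (- Im (a z)) ->
  is_derive (fun s => Im (g (Re z, s))) (Im z) (Re (a z)) ->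
  continuous a z ->
  is_Cderive g z (a z).
Proof.
intros Hx Hy1 Hy2 Ca; destruct z as [x y].
pose proof (proj1 (continuous_C _ _) Ca) as [Ca1 Ca2].
assert (D1 := is_derive_filterdiff (fun s t => Re (g (s, t))) x y
  (fun s t => Re (a (s, t))) (- Im (a (x, y)))).
assert (D2 := is_derive_filterdiff (fun s t => Im (g (s, t))) x y
  (fun s t => Im (a (s, t))) (Re (a (x, y)))).
assert (S : forall c : C, a c = a (fst c, snd c)) by (intros [? ?]; reflexivity).
specialize (D1 ltac:(eapply filter_imp; [|exact Hx]; intros [u v] [h _]; exact h) Hy1).
specialize (D2 ltac:(eapply filter_imp; [|exact Hx]; intros [u v] [_ h]; exact h) Hy2).
specialize (D1 (continuous_ext _ _ _ (fun c => f_equal Re (S c)) Ca1)).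
specialize (D2 (continuous_ext _ _ _ (fun c => f_equal Im (S c)) Ca2)).
exists (slope g (x, y) (a (x, y))); split; [|split].
- apply filterlim_locally; intros e; rewrite slope_diag.
  (* The real and imaginary parts of the remainder contribute [e / 4] each, and the resulting bound
     [e / 2] is strictly below [e]. *)
  assert (He : 0 < e / 4) by (pose proof (cond_pos e); lra).
  pose proof (filterdiff_le _ _ _ _ _ (mkposreal _ He) D1) as B1.
  pose proof (filterdiff_le _ _ _ _ _ (mkposreal _ He) D2) as B2.
  eapply filter_imp; [|exact (filter_and _ _ B1 B2)]; clear B1 B2.
  intros w [B1 B2]; unfold slope.
  destruct (Ceq_dec w (x, y)) as [_|N]; [apply ball_center|].
  apply Cminus_neq_0 in N.
  set (v := ((g w - g (x, y)) / (w - (x, y)) - a (x, y))%C).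
  assert (Ev : (v * (w - (x, y)) = g w - g (x, y) - a (x, y) * (w - (x, y)))%C)
    by (unfold v; field; exact N).
  assert (Bv : Cmod v <= e / 2).
  { apply Rmult_le_reg_r with (Cmod (w - (x, y))); [apply Cmod_gt_0, N|].
    rewrite <- Cmod_mult, Ev.
    set (u := (g w - g (x, y) - a (x, y) * (w - (x, y)))%C).
    assert (Eu : u = (RtoC (Re u) + Ci * RtoC (Im u))%C)
      by (destruct u; apply injective_projections; simpl; ring).
    rewrite Eu; eapply Rle_trans; [apply Cmod_triangle|].
    rewrite Cmod_mult, !Cmod_R, Cmod_Ci.
    assert (E1 : Re u = Re (g (Re w, Im w)) - Re (g (x, y)) -
       ((Re w - x) * Re (a (x, y)) + (Im w - y) * - Im (a (x, y)))).
    { unfold u; destruct w; simpl; unfold Re, Im; simpl; ring. }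
    assert (E2 : Im u = Im (g (Re w, Im w)) - Im (g (x, y)) -
       ((Re w - x) * Im (a (x, y)) + (Im w - y) * Re (a (x, y)))).
    { unfold u; destruct w; simpl; unfold Re, Im; simpl; ring. }
    rewrite E1, E2; simpl in B1, B2; lra. }
  assert (Q := Rmax_Cmod v); assert (Pe := cond_pos e).
  split; [change (Rabs (fst v) < e)|change (Rabs (snd v) < e)];
    (eapply Rle_lt_trans; [|apply Rle_lt_trans with (1 := Q); lra]);
    [apply Rmax_l|apply Rmax_r].
- apply slope_diag.
- apply filter_forall; intros w; apply slopeE.
Qed.

Lemma is_linear_ext {U V : NormedModule R_AbsRing} (f g : U -> V) :
  is_linear f -> (forall x, f x = g x) -> is_linear g.
Proof.
intros [Hp Hs [M HM]] E; split.
- intros x y; rewrite <- !E; apply Hp.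
- intros k x; rewrite <- !E; apply Hs.
- exists M; split; [apply HM|intros x; rewrite <- E; apply HM].
Qed.

Lemma is_linear_qre : is_linear qre.
Proof.
apply is_linear_ext with (fun q : quat => fst (fst (fst q)));
  [|intros [[[a b] c] d]; reflexivity].
apply (is_linear_comp (fun q : quat => fst (fst q)) fst); [|apply is_linear_fst].
apply (is_linear_comp (fun q : quat => fst q) fst); apply is_linear_fst.
Qed.

Lemma is_linear_qi : is_linear qi.
Proof.
apply is_linear_ext with (fun q : quat => snd (fst (fst q)));
  [|intros [[[a b] c] d]; reflexivity].
apply (is_linear_comp (fun q : quat => fst (fst q)) snd); [|apply is_linear_snd].
apply (is_linear_comp (fun q : quat => fst q) fst); apply is_linear_fst.
Qed.

Lemma is_linear_qj : is_linear qj.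
Proof.
apply is_linear_ext with (fun q : quat => snd (fst q));
  [|intros [[[a b] c] d]; reflexivity].
apply (is_linear_comp (fun q : quat => fst q) snd); [apply is_linear_fst|apply is_linear_snd].
Qed.

Lemma is_linear_qk : is_linear qk.
Proof.
apply is_linear_ext with (fun q : quat => snd q);
  [apply is_linear_snd|intros [[[a b] c] d]; reflexivity].
Qed.

(** The C-linear extension to H_C of a real coordinate of H. *)
Definition ccoord (p : quat -> R) (w : quatC) : C := (p (fst w), p (snd w)).

Lemma continuous_ccoord {T : UniformSpace} (p : quat -> R) (f : T -> quatC) (x : T) :
  is_linear p -> continuous f x -> continuous (fun t => ccoord p (f t)) x.
Proof.
intros Hp Hf; apply continuous_pair.
- apply (continuous_comp (fun t => fst (f t)) p); [|exact (linear_cont p _ Hp)].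
  apply (continuous_comp f fst); [exact Hf|apply continuous_fst].
- apply (continuous_comp (fun t => snd (f t)) p); [|exact (linear_cont p _ Hp)].
  apply (continuous_comp f snd); [exact Hf|apply continuous_snd].
Qed.

Lemma is_derive_d_alpha (D : C -> Prop) (F : C -> quatC) (z : C) :
  slice_regular D F -> D z ->
  is_derive (fun s : R => F (s, Im z)) (Re z) (d_alpha F z).
Proof.
intros [HC _] Hz; destruct (HC z Hz) as [[l Hl] _].
unfold d_alpha; rewrite (Derive_quatC_correct _ _ _ Hl); exact Hl.
Qed.

Lemma d_beta_slice_regular (D : C -> Prop) (F : C -> quatC) (z : C) :
  slice_regular D F -> D z -> d_beta F z = mul_sqrtm1 (d_alpha F z).
Proof.
intros [_ H] Hz; specialize (H z Hz); unfold d_zbar, mul_sqrtm1 in *.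
destruct (d_alpha F z) as [[[[a1 a2] a3] a4] [[[a5 a6] a7] a8]].
destruct (d_beta F z) as [[[[b1 b2] b3] b4] [[[b5 b6] b7] b8]].
assert (A : forall x y : R, scal (/ 2) (plus x y) = zero -> x + y = 0)
  by (intros x y E; change (/ 2 * (x + y) = 0) in E; lra).
injection H; intros H8 H7 H6 H5 H4 H3 H2 H1.
apply A in H1, H2, H3, H4, H5, H6, H7, H8.
change ((b1, b2, b3, b4, (b5, b6, b7, b8)) =
  (- a5, - a6, - a7, - a8, (a1, a2, a3, a4))).
unfold opp in *; simpl in *; repeat f_equal; lra.
Qed.

Lemma is_derive_d_beta (D : C -> Prop) (F : C -> quatC) (z : C) :
  slice_regular D F -> D z ->
  is_derive (fun s : R => F (Re z, s)) (Im z) (mul_sqrtm1 (d_alpha F z)).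
Proof.
intros HF Hz; rewrite <- (d_beta_slice_regular D) by assumption.
destruct HF as [HC _]; destruct (HC z Hz) as [_ [[l Hl] _]].
unfold d_beta; rewrite (Derive_quatC_correct _ _ _ Hl); exact Hl.
Qed.

(** Reduction to ordinary holomorphy: multiplication by sqrt(-1) on H_C is multiplication by [i] in
    each complex coordinate, so that the equation for [F] splits into Cauchy-Riemann equations for
    scalar functions. *)
Lemma C1_Cderive_ccoord (D : C -> Prop) (F : C -> quatC) (p : quat -> R) (z : C) :
  open D -> slice_regular D F -> is_linear p -> D z ->
  C1_Cderive (fun w => ccoord p (F w)) (fun w => ccoord p (d_alpha F w)) z.
Proof.
intros Dop HF Hp Hz.
assert (Cp : forall w, D w -> continuous (fun w => ccoord p (d_alpha F w)) w).
{ intros w Hw; apply continuous_ccoord; [exact Hp|].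
  destruct HF as [HC _]; apply (HC w Hw). }
assert (L1 : is_linear (fun w : quatC => p (fst w)))
  by (apply (is_linear_comp (fun w : quatC => fst w) p); [apply is_linear_fst|exact Hp]).
assert (L2 : is_linear (fun w : quatC => p (snd w)))
  by (apply (is_linear_comp (fun w : quatC => snd w) p); [apply is_linear_snd|exact Hp]).
assert (H : forall w, D w -> is_Cderive (fun w => ccoord p (F w)) w (ccoord p (d_alpha F w))).
{ intros w Hw; apply (is_Cderive_partials (fun w => ccoord p (F w))
    (fun w => ccoord p (d_alpha F w))).
  - eapply filter_imp; [|exact (Dop w Hw)]; intros u Hu.
    pose proof (is_derive_d_alpha D F u HF Hu) as Du.
    split; [exact (is_derive_linear _ _ _ _ L1 Du)|exact (is_derive_linear _ _ _ _ L2 Du)].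
  - pose proof (is_derive_linear _ _ _ _ L1 (is_derive_d_beta D F w HF Hw)) as Q.
    unfold mul_sqrtm1 in Q; simpl in Q.
    assert (E : p (opp (snd (d_alpha F w))) = - p (snd (d_alpha F w)))
      by (exact (linear_opp p _ Hp)).
    eapply is_derive_eq; [exact Q|exact E].
  - exact (is_derive_linear _ _ _ _ L2 (is_derive_d_beta D F w HF Hw)).
  - exact (Cp w Hw). }
split; [exact (Cp z Hz)|].
eapply filter_imp; [|exact (Dop z Hz)]; exact H.
Qed.

(** * The complex scalar product and its isotropic vectors *)

Definition qdot (p q : quat) : R :=
  qre p * qre q + qi p * qi q + qj p * qj q + qk p * qk q.

(** The C-bilinear extension to H_C of the scalar product of H. *)
Definition cdot (v w : quatC) : C :=
  (ccoord qre v * ccoord qre w + ccoord qi v * ccoord qi w +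
   ccoord qj v * ccoord qj w + ccoord qk v * ccoord qk w)%C.

Lemma cdotE (p q a b : quat) :
  cdot (p, q) (a, b) = (qdot p a - qdot q b, qdot p b + qdot q a).
Proof.
unfold cdot, ccoord, qdot; apply injective_projections; simpl; ring.
Qed.

Lemma quat_plusE (a b c d a' b' c' d' : R) :
  plus ((a, b, c, d) : quat) (a', b', c', d') = (a + a', b + b', c + c', d + d').
Proof. reflexivity. Qed.

Lemma quat_oppE (a b c d : R) : opp ((a, b, c, d) : quat) = (- a, - b, - c, - d).
Proof. reflexivity. Qed.

Lemma qdot_self_neq0 (q : quat) : q <> zero -> 0 < qdot q q.
Proof.
destruct q as [[[a b] c] d]; unfold qdot; simpl; intros N.
destruct (Rle_lt_dec (a * a + b * b + c * c + d * d) 0) as [L|L]; [exfalso|exact L].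
assert (a = 0) by nra; assert (b = 0) by nra; assert (c = 0) by nra; assert (d = 0) by nra.
subst; apply N; reflexivity.
Qed.

Lemma imag_unit_i : imag_unit (0, 1, 0, 0).
Proof. apply imag_unitP; simpl; split; ring. Qed.

Lemma imag_unit_j : imag_unit (0, 0, 1, 0).
Proof. apply imag_unitP; simpl; split; ring. Qed.

Lemma imag_unit_k : imag_unit (0, 0, 0, 1).
Proof. apply imag_unitP; simpl; split; ring. Qed.

(** For [q] nonzero the only candidate is [J = - p q^{-1}]. The real part of the hypothesis says
    [|p| = |q|], which makes its norm 1; the imaginary part says that [p] and [q] are orthogonal,
    which makes it purely imaginary. For [q = 0] also [p = 0], and any unit will do. *)
Lemma cdot_isotropic (p q : quat) :
  cdot (p, q) (p, q) = 0 -> exists J, imag_unit J /\ plus p (qmul J q) = (0, 0, 0, 0).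
Proof.
rewrite cdotE; intros H; injection H; intros H2 H1; clear H.
destruct (classic (q = zero)) as [E|N].
- exists (0, 1, 0, 0); split; [exact imag_unit_i|].
  change (q = (0, 0, 0, 0)) in E.
  destruct p as [[[p0 p1] p2] p3]; subst q; unfold qdot in *; simpl in *.
  assert (p0 = 0) by nra; assert (p1 = 0) by nra; assert (p2 = 0) by nra;
    assert (p3 = 0) by nra; subst.
  rewrite quat_plusE; apply quat_eq; simpl; ring.
- apply qdot_self_neq0 in N.
  destruct p as [[[p0 p1] p2] p3]; destruct q as [[[q0 q1] q2] q3].
  set (n := qdot (q0, q1, q2, q3) (q0, q1, q2, q3)) in *.
  unfold qdot in H1, H2; simpl in H1, H2.
  assert (En : n = q0 * q0 + q1 * q1 + q2 * q2 + q3 * q3) by reflexivity.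
  clearbody n.
  exists (0, (p0 * q1 - p1 * q0 + p2 * q3 - p3 * q2) / n,
             (p0 * q2 - p2 * q0 + p3 * q1 - p1 * q3) / n,
             (p0 * q3 - p3 * q0 + p1 * q2 - p2 * q1) / n); split.
  + apply imag_unitP; split; [reflexivity|simpl].
    assert (E : p0 * q0 + p1 * q1 + p2 * q2 + p3 * q3 = 0) by lra.
    assert (E2 : p0 * p0 + p1 * p1 + p2 * p2 + p3 * p3 = n) by lra.
    (* Euler's four-square identity for [p] times the conjugate of [q], whose real part is the
       scalar product of [p] and [q]. *)
    assert (E3 : (p0 * q1 - p1 * q0 + p2 * q3 - p3 * q2) ^ 2 +
      (p0 * q2 - p2 * q0 + p3 * q1 - p1 * q3) ^ 2 +
      (p0 * q3 - p3 * q0 + p1 * q2 - p2 * q1) ^ 2 = n * n).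
    { replace (n * n) with ((p0 * p0 + p1 * p1 + p2 * p2 + p3 * p3) *
        (q0 * q0 + q1 * q1 + q2 * q2 + q3 * q3) -
        (p0 * q0 + p1 * q1 + p2 * q2 + p3 * q3) ^ 2)
        by (rewrite E, E2, <- En; ring).
      ring. }
    apply (Rmult_eq_reg_r (n * n)); [|nra].
    rewrite Rmult_1_l; etransitivity; [|exact E3]; field; lra.
  + assert (E : p0 * q0 + p1 * q1 + p2 * q2 + p3 * q3 = 0) by lra.
    (* The witness keeps only the imaginary part of [- p q^{-1}], so each coordinate of [p + J q] is
       the scalar product of [p] and [q] times that of [q / n]. *)
    assert (K : forall x c, x = (p0 * q0 + p1 * q1 + p2 * q2 + p3 * q3) * c / n ->
      x = 0) by (intros x c ->; rewrite E; field; lra).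
    unfold qmul; rewrite quat_plusE; apply quat_eq; simpl;
      [apply K with q0|apply K with q1|apply K with q2|apply K with q3];
      rewrite En in N |- *; field; lra.
Qed.

Lemma cdot_slice (J q : quat) :
  imag_unit J -> cdot (opp (qmul J q), q) (opp (qmul J q), q) = 0.
Proof.
intros HJ; apply imag_unitP in HJ; rewrite cdotE.
destruct J as [[[a b] c] d]; destruct q as [[[q0 q1] q2] q3]; destruct HJ as [Ha H].
simpl in Ha, H; subst a; unfold qmul; rewrite ?quat_oppE; unfold qdot; simpl.
apply injective_projections; simpl; [|ring].
transitivity ((q0 * q0 + q1 * q1 + q2 * q2 + q3 * q3) *
   (b * (b * 1) + c * (c * 1) + d * (d * 1) - 1)); [ring|rewrite H; ring].
Qed.

(** Left multiplication by [J] is orthogonal and skew, so the vectors [p + sqrt(-1) q] with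
    [p + J q = 0] form a totally isotropic subspace. It contains [F z - c] when [c] is the value of
    [f] at [alpha + J beta], and also dF/dz when the slice derivative vanishes there; this makes the
    leading coefficient 0. *)
Lemma cdot_slice_same_unit (J q b : quat) :
  imag_unit J -> cdot (opp (qmul J q), q) (opp (qmul J b), b) = 0.
Proof.
intros HJ; apply imag_unitP in HJ; rewrite cdotE.
destruct J as [[[j0 j1] j2] j3]; destruct q as [[[q0 q1] q2] q3].
destruct b as [[[b0 b1] b2] b3]; destruct HJ as [Ha H].
simpl in Ha, H; subst j0; unfold qmul; rewrite ?quat_oppE; unfold qdot; simpl.
apply injective_projections; simpl; [|ring].
transitivity ((q0 * b0 + q1 * b1 + q2 * b2 + q3 * b3) *
   (j1 * (j1 * 1) + j2 * (j2 * 1) + j3 * (j3 * 1) - 1)); [ring|rewrite H; ring].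
Qed.

(** Coefficient in the direction [e] of the function sending [J] to [cdot (opp (qmul J q), q) w],
    which is affine in [J]. *)
Definition slice_coeff (e q : quat) (w : quatC) : C := cdot (opp (qmul e q), (0, 0, 0, 0)) w.

Lemma cdot_slice_affine (x y z : R) (q : quat) (w : quatC) :
  cdot (opp (qmul (0, x, y, z) q), q) w =
  (cdot ((0, 0, 0, 0), q) w + x * slice_coeff (0, 1, 0, 0) q w +
   y * slice_coeff (0, 0, 1, 0) q w + z * slice_coeff (0, 0, 0, 1) q w)%C.
Proof.
unfold slice_coeff; destruct w as [a b]; rewrite !cdotE; destruct q as [[[q0 q1] q2] q3].
destruct a as [[[a0 a1] a2] a3]; destruct b as [[[b0 b1] b2] b3].
unfold qmul; rewrite !quat_oppE; unfold qdot; simpl.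
apply injective_projections; simpl; ring.
Qed.

(** Up to complex units, the hypotheses are the products of [w] with [q], [iq], [jq] and [kq], an
    orthogonal basis of H and therefore a complex basis of H_C. *)
Lemma cdot_nondegenerate (q : quat) (w : quatC) :
  q <> zero -> cdot ((0, 0, 0, 0), q) w = 0 ->
  slice_coeff (0, 1, 0, 0) q w = 0 -> slice_coeff (0, 0, 1, 0) q w = 0 ->
  slice_coeff (0, 0, 0, 1) q w = 0 -> w = ((0, 0, 0, 0), (0, 0, 0, 0)).
Proof.
unfold slice_coeff.
intros N He Hi Hj Hk; apply qdot_self_neq0 in N; destruct w as [a b].
rewrite cdotE in He, Hi, Hj, Hk.
destruct q as [[[q0 q1] q2] q3]; destruct a as [[[a0 a1] a2] a3].
destruct b as [[[b0 b1] b2] b3].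
unfold qmul in *; rewrite !quat_oppE in *; unfold qdot in *; simpl in *.
injection He; intros He2 He1; injection Hi; intros Hi2 Hi1.
injection Hj; intros Hj2 Hj1; injection Hk; intros Hk2 Hk1.
clear He Hi Hj Hk.
set (n := q0 * q0 + q1 * q1 + q2 * q2 + q3 * q3) in *.
assert (K : forall x, x * n = 0 -> x = 0)
  by (intros x Hx; apply (Rmult_eq_reg_r n); lra).
(* The four rows are [q], [iq], [jq], [kq]; each coordinate of [v], times [n], is recovered by
   expanding [v] in this basis. The real and imaginary parts of [w] are treated separately. *)
assert (G : forall v0 v1 v2 v3,
  q0 * v0 + q1 * v1 + q2 * v2 + q3 * v3 = 0 ->
  - q1 * v0 + q0 * v1 - q3 * v2 + q2 * v3 = 0 ->
  - q2 * v0 + q3 * v1 + q0 * v2 - q1 * v3 = 0 ->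
  - q3 * v0 - q2 * v1 + q1 * v2 + q0 * v3 = 0 ->
  v0 = 0 /\ v1 = 0 /\ v2 = 0 /\ v3 = 0).
{ intros v0 v1 v2 v3 E0 E1 E2 E3; repeat split; apply K; unfold n.
  - transitivity (q0 * (q0 * v0 + q1 * v1 + q2 * v2 + q3 * v3)
      - q1 * (- q1 * v0 + q0 * v1 - q3 * v2 + q2 * v3)
      - q2 * (- q2 * v0 + q3 * v1 + q0 * v2 - q1 * v3)
      - q3 * (- q3 * v0 - q2 * v1 + q1 * v2 + q0 * v3));
      [ring|rewrite E0, E1, E2, E3; ring].
  - transitivity (q1 * (q0 * v0 + q1 * v1 + q2 * v2 + q3 * v3)
      + q0 * (- q1 * v0 + q0 * v1 - q3 * v2 + q2 * v3)
      + q3 * (- q2 * v0 + q3 * v1 + q0 * v2 - q1 * v3)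
      - q2 * (- q3 * v0 - q2 * v1 + q1 * v2 + q0 * v3));
      [ring|rewrite E0, E1, E2, E3; ring].
  - transitivity (q2 * (q0 * v0 + q1 * v1 + q2 * v2 + q3 * v3)
      - q3 * (- q1 * v0 + q0 * v1 - q3 * v2 + q2 * v3)
      + q0 * (- q2 * v0 + q3 * v1 + q0 * v2 - q1 * v3)
      + q1 * (- q3 * v0 - q2 * v1 + q1 * v2 + q0 * v3));
      [ring|rewrite E0, E1, E2, E3; ring].
  - transitivity (q3 * (q0 * v0 + q1 * v1 + q2 * v2 + q3 * v3)
      + q2 * (- q1 * v0 + q0 * v1 - q3 * v2 + q2 * v3)
      - q1 * (- q2 * v0 + q3 * v1 + q0 * v2 - q1 * v3)
      + q0 * (- q3 * v0 - q2 * v1 + q1 * v2 + q0 * v3));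
      [ring|rewrite E0, E1, E2, E3; ring]. }
destruct (G a0 a1 a2 a3) as [-> [-> [-> ->]]]; try lra.
destruct (G b0 b1 b2 b3) as [-> [-> [-> ->]]]; try lra.
reflexivity.
Qed.

(** The three values are those of the affine function with coefficients
    [e, x, y, z] at the rotations of [(a, b, c)] by the angle [t] around the axes. *)
Lemma affine_rotations (e x y z a b c s : R) :
  0 < s < PI -> a ^ 2 + b ^ 2 + c ^ 2 = 1 ->
  (forall t, t = s \/ t = - s \/ t = 0 ->
    e + x * a + y * (b * cos t - c * sin t) + z * (b * sin t + c * cos t) = 0 /\
    e + x * (c * sin t + a * cos t) + y * b + z * (c * cos t - a * sin t) = 0 /\
    e + x * (a * cos t - b * sin t) + y * (a * sin t + b * cos t) + z * c = 0) ->
  e = 0 /\ x = 0 /\ y = 0 /\ z = 0.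
Proof.
intros Hs Hu H.
assert (Sp : 0 < sin s) by (apply sin_gt_0; lra).
assert (Cp : cos s < 1).
{ pose proof (sin2_cos2 s) as Q; unfold Rsqr in Q.
  destruct (Rlt_le_dec (cos s) 1) as [L|L]; [exact L|nra]. }
destruct (H s (or_introl eq_refl)) as [A1 [A2 A3]].
destruct (H (- s) (or_intror (or_introl eq_refl))) as [B1 [B2 B3]].
destruct (H 0 (or_intror (or_intror eq_refl))) as [C1 _].
rewrite cos_neg, sin_neg in B1, B2, B3; rewrite cos_0, sin_0 in C1.
(* The sum of the values at [s] and [- s], compared with the value at 0, leaves a factor
   [1 - cos s]; their difference leaves a factor [sin s]. The equations [X1] to [X3] give
   [x a = y b = z c = 0], while [Y1] to [Y3] say that [(x, y, z)] is parallel to the unit vector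
   [(a, b, c)]; together these leave only 0. *)
assert (X1 : y * b + z * c = 0) by (apply (Rmult_eq_reg_r (1 - cos s)); lra).
assert (X2 : x * a + z * c = 0) by (apply (Rmult_eq_reg_r (1 - cos s)); lra).
assert (X3 : x * a + y * b = 0) by (apply (Rmult_eq_reg_r (1 - cos s)); lra).
assert (Y1 : z * b = y * c) by (apply (Rmult_eq_reg_r (sin s)); lra).
assert (Y2 : x * c = z * a) by (apply (Rmult_eq_reg_r (sin s)); lra).
assert (Y3 : y * a = x * b) by (apply (Rmult_eq_reg_r (sin s)); lra).
assert (E : e = 0) by lra.
assert (xa : x * a = 0) by lra; assert (yb : y * b = 0) by lra;
  assert (zc : z * c = 0) by lra.
repeat split; [exact E| | |].
- rewrite <- (Rmult_1_r x), <- Hu.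
  transitivity (a * (x * a) + b * (x * b) + c * (x * c)); [ring|].
  rewrite xa, <- Y3, Y2; transitivity (a * (y * b) + a * (z * c)); [ring|].
  rewrite yb, zc; ring.
- rewrite <- (Rmult_1_r y), <- Hu.
  transitivity (a * (y * a) + b * (y * b) + c * (y * c)); [ring|].
  rewrite yb, Y3, <- Y1; transitivity (b * (x * a) + b * (z * c)); [ring|].
  rewrite xa, zc; ring.
- rewrite <- (Rmult_1_r z), <- Hu.
  transitivity (a * (z * a) + b * (z * b) + c * (z * c)); [ring|].
  rewrite zc, Y1, <- Y2; transitivity (c * (x * a) + c * (y * b)); [ring|].
  rewrite xa, yb; ring.
Qed.

(** Three circles through [J] on the sphere of units. A unit on a coordinate axis is fixed by the
    rotation around it; with all three axes no [J] is exceptional. *)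
Definition rot_i (J : quat) (t : R) : quat :=
  (0, qi J, qj J * cos t - qk J * sin t, qj J * sin t + qk J * cos t).

Definition rot_j (J : quat) (t : R) : quat :=
  (0, qk J * sin t + qi J * cos t, qj J, qk J * cos t - qi J * sin t).

Definition rot_k (J : quat) (t : R) : quat :=
  (0, qi J * cos t - qj J * sin t, qi J * sin t + qj J * cos t, qk J).

Lemma imag_unit_rot_i (J : quat) (t : R) : imag_unit J -> imag_unit (rot_i J t).
Proof.
rewrite !imag_unitP; intros [_ H]; split; [reflexivity|].
pose proof (sin2_cos2 t) as Q; unfold Rsqr in Q.
transitivity (qi J ^ 2 + (qj J ^ 2 + qk J ^ 2) * (sin t * sin t + cos t * cos t)).
- unfold rot_i; simpl; ring.
- rewrite Q, Rmult_1_r, <- H; ring.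
Qed.

Lemma imag_unit_rot_j (J : quat) (t : R) : imag_unit J -> imag_unit (rot_j J t).
Proof.
rewrite !imag_unitP; intros [_ H]; split; [reflexivity|].
pose proof (sin2_cos2 t) as Q; unfold Rsqr in Q.
transitivity (qj J ^ 2 + (qi J ^ 2 + qk J ^ 2) * (sin t * sin t + cos t * cos t)).
- unfold rot_j; simpl; ring.
- rewrite Q, Rmult_1_r, <- H; ring.
Qed.

Lemma imag_unit_rot_k (J : quat) (t : R) : imag_unit J -> imag_unit (rot_k J t).
Proof.
rewrite !imag_unitP; intros [_ H]; split; [reflexivity|].
pose proof (sin2_cos2 t) as Q; unfold Rsqr in Q.
transitivity (qk J ^ 2 + (qi J ^ 2 + qj J ^ 2) * (sin t * sin t + cos t * cos t)).
- unfold rot_k; simpl; ring.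
- rewrite Q, Rmult_1_r, <- H; ring.
Qed.

Lemma cdot_slice_rotations (J q : quat) (w : quatC) (s : R) :
  imag_unit J -> q <> zero -> 0 < s < PI ->
  (forall t, t = s \/ t = - s \/ t = 0 ->
    cdot (opp (qmul (rot_i J t) q), q) w = 0 /\
    cdot (opp (qmul (rot_j J t) q), q) w = 0 /\
    cdot (opp (qmul (rot_k J t) q), q) w = 0) ->
  w = ((0, 0, 0, 0), (0, 0, 0, 0)).
Proof.
intros HJ N Hs H; apply imag_unitP in HJ; destruct HJ as [_ HJ].
set (e := cdot ((0, 0, 0, 0), q) w).
set (x := slice_coeff (0, 1, 0, 0) q w).
set (y := slice_coeff (0, 0, 1, 0) q w).
set (z := slice_coeff (0, 0, 0, 1) q w).
assert (A : forall p : C -> R, (forall u v, p (u + v)%C = p u + p v) ->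
  (forall (r : R) v, p (r * v)%C = p v * r) -> p 0 = 0 ->
  p e = 0 /\ p x = 0 /\ p y = 0 /\ p z = 0).
{ intros p Pp Ps P0; apply (affine_rotations _ _ _ _ (qi J) (qj J) (qk J) s Hs HJ).
  intros t Ht; destruct (H t Ht) as [H1 [H2 H3]].
  unfold rot_i in H1; unfold rot_j in H2; unfold rot_k in H3.
  rewrite cdot_slice_affine in H1, H2, H3; fold e x y z in H1, H2, H3.
  apply (f_equal p) in H1, H2, H3; rewrite !Pp, !Ps, P0 in H1, H2, H3.
  repeat split; assumption. }
destruct (A Re) as [e1 [x1 [y1 z1]]];
  [intros; reflexivity|intros r [v1 v2]; simpl; ring|reflexivity|].
destruct (A Im) as [e2 [x2 [y2 z2]]];
  [intros; reflexivity|intros r [v1 v2]; simpl; ring|reflexivity|].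
apply (cdot_nondegenerate q w N); apply injective_projections; assumption.
Qed.

(** The units [i], [-i], [j], [k] are affinely independent, so an affine function of [J] that
    vanishes at them is 0. This replaces the rotations once every [J] is available, and not only
    those near a given one. *)
Lemma cdot_slice_span (q : quat) (w : quatC) :
  q <> zero ->
  cdot (opp (qmul (0, 1, 0, 0) q), q) w = 0 ->
  cdot (opp (qmul (0, -1, 0, 0) q), q) w = 0 ->
  cdot (opp (qmul (0, 0, 1, 0) q), q) w = 0 ->
  cdot (opp (qmul (0, 0, 0, 1) q), q) w = 0 ->
  w = ((0, 0, 0, 0), (0, 0, 0, 0)).
Proof.
intros N H1 H2 H3 H4; rewrite cdot_slice_affine in H1, H2, H3, H4.
set (e := cdot ((0, 0, 0, 0), q) w) in *.
set (x := slice_coeff (0, 1, 0, 0) q w) in *.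
set (y := slice_coeff (0, 0, 1, 0) q w) in *.
set (z := slice_coeff (0, 0, 0, 1) q w) in *.
destruct e as [e1 e2] eqn:Ee; destruct x as [x1 x2] eqn:Ex.
destruct y as [y1 y2] eqn:Ey; destruct z as [z1 z2] eqn:Ez.
unfold Cplus, Cmult, RtoC in H1, H2, H3, H4; simpl in H1, H2, H3, H4.
injection H1; intros; injection H2; intros; injection H3; intros; injection H4; intros.
apply (cdot_nondegenerate q w N);
  [fold e; rewrite Ee|fold x; rewrite Ex|fold y; rewrite Ey|fold z; rewrite Ez];
  apply injective_projections; simpl; lra.
Qed.

(** * Zeros along paths *)

Definition sub_quat (w : quatC) (c : quat) : quatC := (minus (fst w) c, snd w).

Lemma ccoord_sub_quat (p : quat -> R) (w : quatC) (c : quat) :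
  is_linear p -> ccoord p (sub_quat w c) = (ccoord p w + RtoC (- p c))%C.
Proof.
intros Hp; unfold ccoord, sub_quat, minus; apply injective_projections; simpl; [|ring].
rewrite (linear_plus _ Hp), (linear_opp _ _ Hp); reflexivity.
Qed.

Lemma C1_Cderive_cdot_self (G G' : C -> quatC) (z : C) :
  (forall p, is_linear p ->
     C1_Cderive (fun w => ccoord p (G w)) (fun w => ccoord p (G' w)) z) ->
  C1_Cderive (fun w => cdot (G w) (G w)) (fun w => (2 * cdot (G w) (G' w))%C) z.
Proof.
intros H.
pose proof (H _ is_linear_qre) as H0; pose proof (H _ is_linear_qi) as H1.
pose proof (H _ is_linear_qj) as H2; pose proof (H _ is_linear_qk) as H3.
pose proof (C1_Cderive_plus _ _ _ _ _ (C1_Cderive_plus _ _ _ _ _ (C1_Cderive_plus _ _ _ _ _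
  (C1_Cderive_mult _ _ _ _ _ H0 H0) (C1_Cderive_mult _ _ _ _ _ H1 H1))
  (C1_Cderive_mult _ _ _ _ _ H2 H2)) (C1_Cderive_mult _ _ _ _ _ H3 H3)) as K.
eapply C1_Cderive_ext; [|exact K].
intros w; unfold cdot; ring.
Qed.

Lemma continuous_cdot {T : UniformSpace} (f g : T -> quatC) (x : T) :
  continuous f x -> continuous g x -> continuous (fun t => cdot (f t) (g t)) x.
Proof.
intros Hf Hg; unfold cdot.
assert (H : forall p, is_linear p ->
  continuous (fun t => (ccoord p (f t) * ccoord p (g t))%C) x).
{ intros p Hp; apply continuous_Cmult; apply continuous_ccoord; assumption. }
apply continuous_Cplus; [apply continuous_Cplus; [apply continuous_Cplus|]|];
  [exact (H _ is_linear_qre)|exact (H _ is_linear_qi)|exact (H _ is_linear_qj)|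
   exact (H _ is_linear_qk)].
Qed.

Lemma continuous_quat {T : UniformSpace} (f : T -> quat) (x : T) :
  continuous (fun t => qre (f t)) x -> continuous (fun t => qi (f t)) x ->
  continuous (fun t => qj (f t)) x -> continuous (fun t => qk (f t)) x ->
  continuous f x.
Proof.
intros H0 H1 H2 H3.
apply continuous_ext with (fun t => (qre (f t), qi (f t), qj (f t), qk (f t))).
- intros t; destruct (f t) as [[[a b] c] d]; reflexivity.
- repeat apply continuous_pair; assumption.
Qed.

Lemma continuous_coord {T : UniformSpace} (p : quat -> R) (f : T -> quat) (x : T) :
  is_linear p -> continuous f x -> continuous (fun t => p (f t)) x.
Proof.
intros Hp Hf; apply (continuous_comp f p); [exact Hf|exact (linear_cont p _ Hp)].
Qed.

Lemma continuous_qmul {T : UniformSpace} (f g : T -> quat) (x : T) :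
  continuous f x -> continuous g x -> continuous (fun t => qmul (f t) (g t)) x.
Proof.
intros Hf Hg.
pose proof (continuous_coord _ _ _ is_linear_qre Hf).
pose proof (continuous_coord _ _ _ is_linear_qi Hf).
pose proof (continuous_coord _ _ _ is_linear_qj Hf).
pose proof (continuous_coord _ _ _ is_linear_qk Hf).
pose proof (continuous_coord _ _ _ is_linear_qre Hg).
pose proof (continuous_coord _ _ _ is_linear_qi Hg).
pose proof (continuous_coord _ _ _ is_linear_qj Hg).
pose proof (continuous_coord _ _ _ is_linear_qk Hg).
assert (M : forall u v : T -> R, continuous u x -> continuous v x ->
  continuous (fun t => u t * v t) x) by (intros; apply (continuous_mult (K := R_AbsRing)); assumption).
assert (P : forall u v : T -> R, continuous u x -> continuous v x ->
  continuous (fun t => u t + v t) x)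
  by (intros; apply (continuous_plus (V := R_NormedModule)); assumption).
assert (S : forall u v : T -> R, continuous u x -> continuous v x ->
  continuous (fun t => u t - v t) x)
  by (intros; apply (continuous_minus (V := R_NormedModule)); assumption).
apply continuous_ext with (fun t =>
  (qre (f t) * qre (g t) - qi (f t) * qi (g t) - qj (f t) * qj (g t) - qk (f t) * qk (g t),
   qre (f t) * qi (g t) + qi (f t) * qre (g t) + qj (f t) * qk (g t) - qk (f t) * qj (g t),
   qre (f t) * qj (g t) - qi (f t) * qk (g t) + qj (f t) * qre (g t) + qk (f t) * qi (g t),
   qre (f t) * qk (g t) + qi (f t) * qj (g t) - qj (f t) * qi (g t) + qk (f t) * qre (g t))).
- intros t; destruct (f t) as [[[a b] c] d]; destruct (g t) as [[[a' b'] c'] d']; reflexivity.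
- repeat apply continuous_pair;
    [apply S; [apply S; [apply S|]|]|apply S; [apply P; [apply P|]|]|
     apply P; [apply P; [apply S|]|]|apply P; [apply S; [apply P|]|]];
    apply M; assumption.
Qed.

Lemma continuous_sub_quat {T : UniformSpace} (f : T -> quatC) (c : T -> quat) (x : T) :
  continuous f x -> continuous c x -> continuous (fun t => sub_quat (f t) (c t)) x.
Proof.
intros Hf Hc.
refine (continuous_pair (fun t => minus (fst (f t)) (c t)) (fun t => snd (f t)) x _ _).
- apply (continuous_minus (V := prod_NormedModule R_AbsRing (prod_NormedModule R_AbsRing
    (prod_NormedModule R_AbsRing R_NormedModule R_NormedModule) R_NormedModule)
    R_NormedModule)); [|exact Hc].
  apply (continuous_comp f fst); [exact Hf|apply continuous_fst].
- apply (continuous_comp f snd); [exact Hf|apply continuous_snd].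
Qed.

Lemma continuous_slice_regular (D : C -> Prop) (F : C -> quatC) (z : C) :
  open D -> slice_regular D F -> D z -> continuous F z.
Proof.
intros Dop HF Hz.
assert (H : forall p, is_linear p -> continuous (fun w => ccoord p (F w)) z).
{ intros p Hp; eapply is_Cderive_continuous, C1_Cderive_is_Cderive.
  exact (C1_Cderive_ccoord D F p z Dop HF Hp Hz). }
assert (H1 : forall p, is_linear p -> continuous (fun w => p (fst (F w))) z)
  by (intros p Hp; exact (proj1 (proj1 (continuous_C _ _) (H p Hp)))).
assert (H2 : forall p, is_linear p -> continuous (fun w => p (snd (F w))) z)
  by (intros p Hp; exact (proj2 (proj1 (continuous_C _ _) (H p Hp)))).
apply continuous_ext with (fun w => (fst (F w), snd (F w)));
  [intros w; symmetry; apply surjective_pairing|].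
apply continuous_pair; apply continuous_quat;
  [exact (H1 _ is_linear_qre)|exact (H1 _ is_linear_qi)|exact (H1 _ is_linear_qj)|
   exact (H1 _ is_linear_qk)|exact (H2 _ is_linear_qre)|exact (H2 _ is_linear_qi)|
   exact (H2 _ is_linear_qj)|exact (H2 _ is_linear_qk)].
Qed.

Lemma C1_Cderive_cdot_sub (D : C -> Prop) (F : C -> quatC) (c : quat) (z : C) :
  open D -> slice_regular D F -> D z ->
  C1_Cderive (fun w => cdot (sub_quat (F w) c) (sub_quat (F w) c))
    (fun w => (2 * cdot (sub_quat (F w) c) (d_alpha F w))%C) z.
Proof.
intros Dop HF Hz.
apply (C1_Cderive_cdot_self (fun w => sub_quat (F w) c)); intros p Hp.
apply C1_Cderive_ext_loc with (fun w => (ccoord p (F w) + RtoC (- p c))%C).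
- apply filter_forall; intros w; symmetry; apply ccoord_sub_quat, Hp.
- eapply C1_Cderive_ext; [|apply C1_Cderive_plus;
    [exact (C1_Cderive_ccoord D F p z Dop HF Hp Hz)|apply C1_Cderive_const]].
  intros w; simpl; ring.
Qed.

Lemma Cmod_ball (z w : C) (e : R) : ball z e w -> Cmod (w - z) < 2 * e.
Proof.
intros [H1 H2].
change (Rabs (fst w - fst z) < e) in H1; change (Rabs (snd w - snd z) < e) in H2.
eapply Rle_lt_trans; [apply Cmod_2Rmax|].
assert (E : Rmax (Rabs (fst (w - z)%C)) (Rabs (snd (w - z)%C)) < e).
{ apply Rmax_lub_lt; [exact H1|exact H2]. }
assert (S : 0 <= sqrt 2) by apply sqrt_pos.
assert (S2 : sqrt 2 * sqrt 2 = 2) by (apply sqrt_sqrt; lra).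
assert (B := Rabs_pos (fst w - fst z)).
nra.
Qed.

Lemma ball_Cmod (z w : C) (e : R) : Cmod (w - z) < e -> ball z e w.
Proof.
intros H; assert (Q := Rmax_Cmod (w - z)%C).
split; [change (Rabs (fst (w - z)%C) < e)|change (Rabs (snd (w - z)%C) < e)];
  (eapply Rle_lt_trans; [|apply Rle_lt_trans with (1 := Q); exact H]);
  [apply Rmax_l|apply Rmax_r].
Qed.

Lemma path_vanishing (D : C -> Prop) (F : C -> quatC) (n : nat) (z : R -> C)
    (c : R -> quat) (l : R -> C) (rho eta : posreal) :
  open D -> slice_regular D F ->
  (forall w, Cmod (w - z 0) < rho -> D w) ->
  (forall s w, Rabs s < eta -> Cmod (z s - z 0) < rho -> Cmod (w - z 0) < rho ->
     cdot (sub_quat (F w) (c s)) (sub_quat (F w) (c s)) = 0 -> w = z s) ->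
  (forall s, Rabs s < eta -> D (z s) -> exists q : C -> C,
     continuous q (z s) /\ q (z s) = l s /\
     forall w, cdot (sub_quat (F w) (c s)) (sub_quat (F w) (c s)) =
       (q w * (w - z s) ^ n)%C) ->
  continuous z 0 -> continuous c 0 -> continuous l 0 -> l 0 = 0 ->
  exists d : posreal, forall s, Rabs s < d -> l s = 0.
Proof.
intros Dop HF HD Hu Hq Cz Cc Cl l0.
assert (Pr := cond_pos rho).
(* Passing from the product ball to the modulus costs a factor 2, so [z s] stays within [rho / 4] of
   [z 0]. The disc of radius [rho / 2] around [z s] then lies in the disc of radius [rho] around
   [z 0], where the zero is unique, and the circle of radius [rho / 4] lies inside it. *)
assert (Hr8 : 0 < rho / 8) by lra.
destruct (proj1 (filterlim_locally _ _) Cz (mkposreal _ Hr8)) as [e He].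
assert (Hz : forall s, Rabs s < e -> Cmod (z s - z 0) < rho / 4).
{ intros s Hs; replace (rho / 4) with (2 * (rho / 8)) by field.
  apply Cmod_ball, He; change (Rabs (s - 0) < e); rewrite Rminus_0_r; exact Hs. }
apply (vanishing_leading_coeff
  (fun s w => cdot (sub_quat (F w) (c s)) (sub_quat (F w) (c s)))
  (fun s w => 2 * cdot (sub_quat (F w) (c s)) (d_alpha F w))%C
  z l n (rho / 2) (rho / 4) (mkposreal _ (Rmin_stable_in_posreal e eta)));
  try assumption; [lra| | |]; simpl.
- intros s Hs.
  assert (H1 : Rabs s < e) by (eapply Rlt_le_trans; [exact Hs|apply Rmin_l]).
  assert (H2 : Rabs s < eta) by (eapply Rlt_le_trans; [exact Hs|apply Rmin_r]).
  apply Hq; [exact H2|apply HD; specialize (Hz s H1); lra].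
- intros s w Hs [Hw0 Hw].
  assert (H1 : Rabs s < e) by (eapply Rlt_le_trans; [exact Hs|apply Rmin_l]).
  assert (H2 : Rabs s < eta) by (eapply Rlt_le_trans; [exact Hs|apply Rmin_r]).
  assert (Hw' : Cmod (w - z 0) < rho).
  { replace (w - z 0)%C with ((w - z s) + (z s - z 0))%C by ring.
    eapply Rle_lt_trans; [apply Cmod_triangle|]; specialize (Hz s H1); lra. }
  split.
  + intros E; apply Hu in E; [|assumption|specialize (Hz s H1); lra|assumption].
    subst w; replace (z s - z s)%C with (RtoC 0) in Hw0 by ring.
    rewrite Cmod_0 in Hw0; lra.
  + apply (C1_Cderive_cdot_sub D); [assumption|assumption|exact (HD w Hw')].
- intros t.
  assert (Cz' : continuous (fun u : R * R => z (fst u)) (0, t))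
    by (apply (continuous_comp fst z); [apply continuous_fst|exact Cz]).
  assert (CG : continuous (fun u : R * R =>
    sub_quat (F (circle_pt (z (fst u)) (rho / 4) (snd u))) (c (fst u))) (0, t)).
  { assert (CF : continuous (fun u : R * R =>
      F (circle_pt (z (fst u)) (rho / 4) (snd u))) (0, t)).
    { apply (continuous_comp (fun u : R * R => circle_pt (z (fst u)) (rho / 4) (snd u)) F).
      - apply continuous_circle_pt; [exact Cz'|apply continuous_const|apply continuous_snd].
      - apply (continuous_slice_regular D); [exact Dop|exact HF|apply HD].
        simpl; rewrite Cmod_circle_pt; lra. }
    apply continuous_sub_quat; [exact CF|].
    apply (continuous_comp fst c); [apply continuous_fst|exact Cc]. }
  exact (continuous_cdot _ _ _ CG CG).
Qed.

(** * Consequences of injectivity *)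

Definition injective_on_circularization (D : C -> Prop) (F : C -> quatC) : Prop :=
  forall x y : quat, circularization D x -> circularization D y ->
    slice_fun F x = slice_fun F y -> x = y.

Lemma qre_slice_pt (a b : R) (J : quat) : imag_unit J -> qre (slice_pt a b J) = a.
Proof.
intros HJ; apply imag_unitP in HJ; destruct J as [[[j0 j1] j2] j3].
destruct HJ as [H _]; simpl in H; subst j0.
change (a + b * 0 = a); ring.
Qed.

Lemma circularization_slice_pt (D : C -> Prop) (z : C) (J : quat) :
  D z -> imag_unit J -> circularization D (slice_pt (Re z) (Im z) J).
Proof.
intros Hz HJ; exists (Re z), (Im z), J; split; [destruct z; exact Hz|].
split; [exact HJ|reflexivity].
Qed.

Lemma slice_pt_eq (z w : C) (J K : quat) :
  imag_unit J -> imag_unit K ->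
  slice_pt (Re z) (Im z) J = slice_pt (Re w) (Im w) K ->
  Re z = Re w /\ Rabs (Im z) = Rabs (Im w).
Proof.
intros HJ HK E; split.
- apply (f_equal qre) in E; rewrite !qre_slice_pt in E by assumption; exact E.
- apply (f_equal imag_norm) in E; rewrite !imag_norm_slice_pt in E by assumption; exact E.
Qed.

Lemma slice_funE (D : C -> Prop) (F : C -> quatC) (z : C) (J : quat) :
  is_stem D F -> D z -> imag_unit J ->
  slice_fun F (slice_pt (Re z) (Im z) J) = plus (fst (F z)) (qmul J (snd (F z))).
Proof.
destruct z as [a b]; intros HF Hz HJ; exact (slice_fun_slice_pt D F a b J HF Hz HJ).
Qed.

Lemma injective_same_value (D : C -> Prop) (F : C -> quatC) (z w : C) (J K : quat) :
  is_stem D F -> injective_on_circularization D F -> D z -> D w ->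
  imag_unit J -> imag_unit K ->
  plus (fst (F z)) (qmul J (snd (F z))) = plus (fst (F w)) (qmul K (snd (F w))) ->
  slice_pt (Re z) (Im z) J = slice_pt (Re w) (Im w) K.
Proof.
intros HF Hi Hz Hw HJ HK E; apply Hi.
- apply circularization_slice_pt; assumption.
- apply circularization_slice_pt; assumption.
- rewrite !(slice_funE D) by assumption; exact E.
Qed.

Lemma plus_minus_cancel (p c v : quat) :
  plus (minus p c) v = (0, 0, 0, 0) -> plus p v = c.
Proof.
destruct p as [[[p0 p1] p2] p3]; destruct c as [[[c0 c1] c2] c3].
destruct v as [[[v0 v1] v2] v3]; unfold minus; rewrite quat_oppE, !quat_plusE.
intros E; injection E; intros; apply quat_eq; simpl; lra.
Qed.

Lemma sub_quat_slice (p q : quat) (x : quat) :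
  sub_quat (p, q) (plus p x) = (opp x, q).
Proof.
destruct p as [[[p0 p1] p2] p3]; destruct x as [[[c0 c1] c2] c3].
unfold sub_quat, minus; simpl fst; simpl snd; f_equal.
rewrite quat_plusE, !quat_oppE, quat_plusE; apply quat_eq; simpl; ring.
Qed.

(** A zero of the form at [w] is a second representation of the point where [f] takes the value [c].
    Conjugating while changing the sign of the unit preserves a point, so [w] may still be the
    conjugate of [z]; this is excluded separately near nonreal and near real points. *)
Lemma zero_same_sphere (D : C -> Prop) (F : C -> quatC) (z w : C) (J : quat) :
  is_stem D F -> injective_on_circularization D F -> D z -> D w -> imag_unit J ->
  let c := plus (fst (F z)) (qmul J (snd (F z))) in
  cdot (sub_quat (F w) c) (sub_quat (F w) c) = 0 ->
  Re w = Re z /\ Rabs (Im w) = Rabs (Im z).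
Proof.
intros HF Hi Hz Hw HJ c E.
destruct (cdot_isotropic _ _ E) as [K [HK EK]].
apply plus_minus_cancel in EK.
apply (slice_pt_eq w z K J HK HJ).
apply (injective_same_value D F); assumption.
Qed.

Lemma d_z_slice_regular (D : C -> Prop) (F : C -> quatC) (z : C) :
  slice_regular D F -> D z -> d_z F z = d_alpha F z.
Proof.
intros HF Hz; unfold d_z; rewrite (d_beta_slice_regular D F z HF Hz).
destruct (d_alpha F z) as [[[[a1 a2] a3] a4] [[[b1 b2] b3] b4]].
(* [mul_sqrtm1] applied twice is negation, so every real coordinate reduces to
   [(x - - x) / 2 = x]. *)
repeat (apply injective_projections);
  match goal with |- _ = ?b => match b with context [?x] => is_var x;
    change (/ 2 * (x - - x) = x); field end end.
Qed.

Lemma injective_no_flat_segment (D : C -> Prop) (F : C -> quatC) (z : C) (d : posreal) :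
  slice_regular D F -> is_stem D F -> injective_on_circularization D F ->
  (forall s, Rabs s < d -> D (Re z + s, Im z) /\
     d_alpha F (Re z + s, Im z) = ((0, 0, 0, 0), (0, 0, 0, 0))) -> False.
Proof.
intros HF Hs Hi H; assert (Pd := cond_pos d).
assert (E : F (Re z, Im z) = F (Re z + d / 2, Im z)).
{ apply (eq_is_derive (fun s : R => F (s, Im z))); [|lra].
  intros t Ht; destruct (H (t - Re z)) as [H1 H2]; [apply Rabs_def1; lra|].
  replace (Re z + (t - Re z)) with t in H1, H2 by ring.
  pose proof (is_derive_d_alpha D F (t, Im z) HF H1) as Q; rewrite H2 in Q; exact Q. }
assert (D1 : D (Re z, Im z)).
{ destruct (H 0) as [H1 _]; [rewrite Rabs_R0; exact Pd|].
  rewrite Rplus_0_r in H1; exact H1. }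
assert (D2 : D (Re z + d / 2, Im z)) by (apply H; rewrite Rabs_pos_eq; lra).
assert (Q := injective_same_value D F _ _ (0, 1, 0, 0) (0, 1, 0, 0) Hs Hi D1 D2
  imag_unit_i imag_unit_i).
rewrite <- E in Q; specialize (Q eq_refl).
apply slice_pt_eq in Q; try exact imag_unit_i; destruct Q as [Q _]; simpl in Q; lra.
Qed.

(** Otherwise [f] would be constant on the sphere through [z], which contains distinct points for
    the units [i] and [j]. *)
Lemma snd_stem_neq0 (D : C -> Prop) (F : C -> quatC) (z : C) :
  is_stem D F -> injective_on_circularization D F -> D z -> Im z <> 0 ->
  snd (F z) <> zero.
Proof.
intros HF Hi Hz Nz E.
assert (Q := injective_same_value D F z z _ _ HF Hi Hz Hz imag_unit_i imag_unit_j).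
rewrite E in Q.
assert (Z : qmul (0, 1, 0, 0) zero = qmul (0, 0, 1, 0) zero).
{ change (qmul (0, 1, 0, 0) (0, 0, 0, 0) = qmul (0, 0, 1, 0) (0, 0, 0, 0)).
  apply quat_eq; simpl; ring. }
rewrite Z in Q; specialize (Q eq_refl).
apply (f_equal qi) in Q; change (0 + Im z * 1 = 0 + Im z * 0) in Q; lra.
Qed.

Lemma ball_in_open (D : C -> Prop) (z : C) :
  open D -> D z -> exists e : posreal, forall w, Cmod (w - z) < e -> D w.
Proof.
intros Dop Hz; destruct (Dop z Hz) as [e He]; exists e; intros w Hw.
apply He, ball_Cmod, Hw.
Qed.

Lemma stem_real_axis (D : C -> Prop) (F : C -> quatC) (a : R) :
  is_stem D F -> D (a, 0) -> snd (F (a, 0)) = (0, 0, 0, 0).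
Proof.
intros HF Hz; destruct (HF _ Hz) as [_ H].
unfold Cconj in H; simpl in H; rewrite Ropp_0 in H.
destruct (snd (F (a, 0))) as [[[x y] u] v]; rewrite quat_oppE in H.
injection H; intros; repeat f_equal; lra.
Qed.

Lemma plus_eq_zero (p q : quat) : plus p q = (0, 0, 0, 0) -> p = opp q.
Proof.
destruct p as [[[p0 p1] p2] p3]; destruct q as [[[q0 q1] q2] q3].
rewrite quat_plusE, quat_oppE; intros E; injection E; intros; repeat f_equal; lra.
Qed.

(** * Degenerate derivatives along paths *)

Section Paths.

Variables (D : C -> Prop) (F : C -> quatC).
Hypotheses (D_open : open D) (F_stem : is_stem D F) (F_regular : slice_regular D F).
Hypothesis f_inj : injective_on_circularization D F.

Lemma nonreal_path (z : R -> C) (J : R -> quat) :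
  D (z 0) -> Im (z 0) <> 0 -> continuous z 0 -> continuous J 0 ->
  (forall s, imag_unit (J s)) ->
  let l s := cdot (opp (qmul (J s) (snd (F (z s)))), snd (F (z s))) (d_alpha F (z s)) in
  l 0 = 0 -> exists d : posreal, forall s, Rabs s < d -> l s = 0.
Proof.
intros Hz Nz Cz CJ HJ l l0.
destruct (ball_in_open D (z 0) D_open Hz) as [e He].
assert (P2 : 0 < Rabs (Im (z 0))) by (apply Rabs_pos_lt; exact Nz).
(* A disc of radius at most [|Im (z 0)|] stays in the open half-plane of [z 0], so equality of
   [|Im w|] and [|Im (z s)|] there excludes the conjugate. *)
set (rho := mkposreal _ (Rmin_stable_in_posreal e (mkposreal _ P2))).
assert (R1 : rho <= e) by apply Rmin_l.
assert (R2 : rho <= Rabs (Im (z 0))) by apply Rmin_r.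
assert (HD : forall w, Cmod (w - z 0) < rho -> D w) by (intros w Hw; apply He; lra).
assert (CF : continuous (fun s => F (z s)) 0).
{ apply (continuous_comp z F); [exact Cz|].
  apply (continuous_slice_regular D); assumption. }
assert (CF2 : continuous (fun s => snd (F (z s))) 0)
  by (apply (continuous_comp (fun s => F (z s)) snd); [exact CF|apply continuous_snd]).
assert (CF1 : continuous (fun s => fst (F (z s))) 0)
  by (apply (continuous_comp (fun s => F (z s)) fst); [exact CF|apply continuous_fst]).
assert (CJF : continuous (fun s => qmul (J s) (snd (F (z s)))) 0)
  by (apply continuous_qmul; assumption).
assert (ES : forall s, sub_quat (F (z s)) (plus (fst (F (z s))) (qmul (J s) (snd (F (z s))))) =
  (opp (qmul (J s) (snd (F (z s)))), snd (F (z s)))).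
{ intros s; rewrite (surjective_pairing (F (z s))) at 1; apply sub_quat_slice. }
assert (Cc : continuous (fun s => plus (fst (F (z s))) (qmul (J s) (snd (F (z s))))) 0)
  by (apply (continuous_plus (V := prod_NormedModule R_AbsRing (prod_NormedModule R_AbsRing
    (prod_NormedModule R_AbsRing R_NormedModule R_NormedModule) R_NormedModule)
    R_NormedModule)); assumption).
(* Here [c s] is the value of [f] at the moving point with unit [J s]; the coefficient of the simple
   zero is [2 * l s], since the derivative of a square is involved. The bound 1 on [s] is
   arbitrary. *)
destruct (path_vanishing D F 1 z (fun s => plus (fst (F (z s))) (qmul (J s) (snd (F (z s)))))
  (fun s => 2 * l s)%C rho (mkposreal 1 Rlt_0_1)) as [d Hd]; try assumption.
- intros s w _ Hzs Hw E.
  destruct (zero_same_sphere D F (z s) w (J s)) as [E1 E2]; try assumption; auto.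
  apply injective_projections; [exact E1|].
  assert (S : forall u, Cmod (u - z 0) < rho -> 0 < Im u * Im (z 0)).
  { intros u Hu; assert (Q := Rmax_Cmod (u - z 0)%C).
    assert (Q2 := Rmax_r (Rabs (fst (u - z 0)%C)) (Rabs (snd (u - z 0)%C))).
    assert (Q3 : Rabs (Im u - Im (z 0)) < Rabs (Im (z 0))).
    { change (Rabs (snd (u - z 0)%C) < Rabs (Im (z 0))); lra. }
    clear - Q3; revert Q3; unfold Rabs; destruct (Rcase_abs _); destruct (Rcase_abs _); nra. }
  specialize (S w Hw) as S1; specialize (S (z s) Hzs) as S2; clear - E2 S1 S2.
  change (Im w = Im (z s)); revert E2; unfold Rabs.
  destruct (Rcase_abs _); destruct (Rcase_abs _); intros E2; nra.
- intros s _ Ds.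
  pose proof (C1_Cderive_is_Cderive _ _ _ (C1_Cderive_cdot_sub D F
    (plus (fst (F (z s))) (qmul (J s) (snd (F (z s))))) (z s) D_open F_regular Ds)) as Q.
  cbv beta in Q; rewrite ES in Q; fold (l s) in Q.
  eexists; split; [exact (continuous_slope _ _ _ Q)|split; [apply slope_diag|]].
  intros w; rewrite (slopeE (fun w => cdot (sub_quat (F w) _) (sub_quat (F w) _)) (z s)
    (2 * l s)%C w).
  rewrite ES, (cdot_slice _ _ (HJ s)), Cpow_1_r; ring.
- apply continuous_Cmult; [apply continuous_const|].
  apply continuous_cdot.
  + exact (continuous_ext _ _ _ ES (continuous_sub_quat _ _ _ CF Cc)).
  + apply (continuous_comp z (d_alpha F)); [exact Cz|].
    destruct F_regular as [HC _]; apply (HC (z 0) Hz).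
- rewrite l0; ring.
- exists d; intros s Hs; specialize (Hd s Hs); cbv beta in Hd.
  replace (l s) with (/ 2 * (2 * l s))%C by (field; intros E; injection E; lra).
  rewrite Hd; ring.
Qed.

(** Each of the four coordinates of [F - F z] has a factor [w - z], so the sum of their squares has
    two. This concerns the form of [F - c] at real points, where [F z] is the quaternion [c]
    itself. *)
Lemma ccoord_slopes (z : C) :
  D z -> exists q : C -> C, continuous q z /\
    q z = cdot (d_alpha F z) (d_alpha F z) /\
    forall w, cdot (minus (F w) (F z)) (minus (F w) (F z)) = (q w * (w - z) ^ 2)%C.
Proof.
intros Hz.
assert (S : forall p, is_linear p -> exists q : C -> C, continuous q z /\
  q z = ccoord p (d_alpha F z) /\
  forall w, ccoord p (minus (F w) (F z)) = (q w * (w - z))%C).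
{ intros p Hp.
  pose proof (C1_Cderive_is_Cderive _ _ _
    (C1_Cderive_ccoord D F p z D_open F_regular Hp Hz)) as Q.
  eexists; split; [exact (continuous_slope _ _ _ Q)|split; [apply slope_diag|]].
  intros w.
  assert (E : ccoord p (minus (F w) (F z)) = (ccoord p (F w) - ccoord p (F z))%C).
  { unfold ccoord, minus; apply injective_projections; simpl;
      rewrite (linear_plus _ Hp), (linear_opp _ _ Hp); reflexivity. }
  rewrite E, (slopeE (fun w => ccoord p (F w)) z (ccoord p (d_alpha F z)) w) at 1; ring. }
destruct (S _ is_linear_qre) as [q0 [C0 [V0 E0]]].
destruct (S _ is_linear_qi) as [q1 [C1 [V1 E1]]].
destruct (S _ is_linear_qj) as [q2 [C2 [V2 E2]]].
destruct (S _ is_linear_qk) as [q3 [C3 [V3 E3]]].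
exists (fun w => q0 w * q0 w + q1 w * q1 w + q2 w * q2 w + q3 w * q3 w)%C.
split; [|split].
- apply continuous_Cplus; [apply continuous_Cplus; [apply continuous_Cplus|]|];
    apply continuous_Cmult; assumption.
- rewrite V0, V1, V2, V3; reflexivity.
- intros w; unfold cdot; rewrite E0, E1, E2, E3; ring.
Qed.

Lemma real_path (a : R) :
  conj_symmetric D -> D (a, 0) -> d_alpha F (a, 0) = ((0, 0, 0, 0), (0, 0, 0, 0)) ->
  exists d : posreal, forall s, Rabs s < d -> D (a + s, 0) /\
    d_alpha F (a + s, 0) = ((0, 0, 0, 0), (0, 0, 0, 0)).
Proof.
intros Dsym Hz HA.
set (z := fun s => (a + s, 0) : C).
assert (Ez : z 0 = (a, 0)) by (unfold z; rewrite Rplus_0_r; reflexivity).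
rewrite <- Ez in Hz, HA.
assert (Cz : continuous z 0).
{ apply continuous_pair; [|apply continuous_const].
  apply (continuous_plus (V := R_NormedModule)); [apply continuous_const|apply continuous_id]. }
assert (CF : continuous (fun s => fst (F (z s))) 0).
{ apply (continuous_comp z (fun w => fst (F w))); [exact Cz|].
  apply (continuous_comp F fst); [|apply continuous_fst].
  apply (continuous_slice_regular D); assumption. }
destruct (ball_in_open D (z 0) D_open Hz) as [e He].
assert (HzD : forall s, Rabs s < e -> D (z s)).
{ intros s Hs; apply He.
  replace (z s - z 0)%C with (RtoC s)
    by (apply injective_projections; simpl; ring).
  rewrite Cmod_R; exact Hs. }
assert (ES : forall s w, D (z s) -> sub_quat (F w) (fst (F (z s))) = minus (F w) (F (z s))).
{ intros s w Hs; pose proof (stem_real_axis D F _ F_stem Hs) as E; fold (z s) in E.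
  unfold sub_quat; destruct (F w) as [u v]; destruct (F (z s)) as [u' v']; simpl in *.
  subst v'; unfold minus; apply injective_projections; [reflexivity|].
  destruct v as [[[v0 v1] v2] v3]; apply quat_eq; simpl;
  match goal with |- ?x = _ => change (x = x + - 0); ring end. }
(* At a real point every unit gives the same value of [f]; [i] merely fills the place of [J] in
   [zero_same_sphere]. *)
assert (EP : forall s, plus (fst (F (z s))) (qmul (0, 1, 0, 0) (0, 0, 0, 0)) = fst (F (z s))).
{ intros s; destruct (fst (F (z s))) as [[[v0 v1] v2] v3]; unfold qmul.
  rewrite quat_plusE; apply quat_eq; simpl; ring. }
destruct (path_vanishing D F 2 z (fun s => fst (F (z s)))
  (fun s => cdot (d_alpha F (z s)) (d_alpha F (z s))) e e) as [d Hd]; try assumption.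
- intros s w Hs _ Hw E.
  assert (Ds := HzD s Hs).
  pose proof (zero_same_sphere D F (z s) w _ F_stem f_inj Ds (He w Hw) imag_unit_i) as Q.
  cbv zeta in Q; pose proof (stem_real_axis D F _ F_stem Ds) as Z; fold (z s) in Z.
  rewrite Z, EP in Q.
  destruct (Q E) as [Q1 Q2].
  apply injective_projections; [exact Q1|].
  unfold z in Q2 |- *; simpl in Q2 |- *; rewrite Rabs_R0 in Q2.
  destruct (Req_dec (snd w) 0) as [K|K]; [exact K|].
  apply Rabs_pos_lt in K; unfold Im in Q2; lra.
- intros s Hs Ds; destruct (ccoord_slopes (z s) Ds) as [q [Cq [Vq Eq]]].
  exists q; split; [exact Cq|split; [exact Vq|]].
  intros w; rewrite (ES s w Ds); apply Eq.
- assert (CA : continuous (fun s => d_alpha F (z s)) 0).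
  { apply (continuous_comp z (d_alpha F)); [exact Cz|].
    destruct F_regular as [HC _]; apply (HC (z 0) Hz). }
  exact (continuous_cdot _ _ _ CA CA).
- rewrite HA, cdotE; unfold qdot; apply injective_projections; simpl; ring.
- exists (mkposreal _ (Rmin_stable_in_posreal d e)); intros s Hs; simpl in Hs.
  assert (H1 : Rabs s < d) by (eapply Rlt_le_trans; [exact Hs|apply Rmin_l]).
  assert (H2 : Rabs s < e) by (eapply Rlt_le_trans; [exact Hs|apply Rmin_r]).
  assert (Ds := HzD s H2); split; [exact Ds|].
  (* The derivative is again a stem function, hence has no sqrt(-1) part on the real axis. There the
     complex form is the squared norm of a quaternion and vanishes only at 0. *)
  pose proof (stem_real_axis D (d_z F) _ (is_stem_d_z D F D_open Dsym F_stem
    (proj1 F_regular)) Ds) as Z.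
  rewrite (d_z_slice_regular D) in Z by assumption.
  specialize (Hd s H1); cbv beta in Hd; fold (z s) in Z |- *.
  destruct (d_alpha F (z s)) as [p q]; simpl in Z; subst q.
  rewrite cdotE in Hd; apply (f_equal Re) in Hd; unfold qdot in Hd; simpl in Hd.
  f_equal; destruct p as [[[p0 p1] p2] p3]; simpl in Hd.
  assert (p0 = 0) by nra; assert (p1 = 0) by nra; assert (p2 = 0) by nra;
    assert (p3 = 0) by nra; subst; reflexivity.
Qed.

Lemma nonreal_flat (z : C) (J : quat) :
  D z -> Im z <> 0 -> imag_unit J ->
  cdot (opp (qmul J (snd (F z))), snd (F z)) (d_alpha F z) = 0 ->
  d_alpha F z = ((0, 0, 0, 0), (0, 0, 0, 0)).
Proof.
intros Hz Nz HJ H0.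
assert (Nq := snd_stem_neq0 D F z F_stem f_inj Hz Nz).
assert (R0 : rot_i J 0 = J /\ rot_j J 0 = J /\ rot_k J 0 = J).
{ apply imag_unitP in HJ; destruct J as [[[j0 j1] j2] j3]; destruct HJ as [E _].
  simpl in E; subst j0; unfold rot_i, rot_j, rot_k; rewrite cos_0, sin_0; simpl.
  repeat split; repeat f_equal; ring. }
destruct R0 as [Ri [Rj Rk]].
assert (Ct : forall x y : R, continuous (fun t => x * cos t + y * sin t) 0).
{ intros x y; apply (ex_derive_continuous (V := R_NormedModule)); auto_derive; exact I. }
assert (P : forall K : R -> quat, K 0 = J -> (forall t, imag_unit (K t)) ->
  continuous K 0 -> exists d : posreal, forall t, Rabs t < d ->
  cdot (opp (qmul (K t) (snd (F z))), snd (F z)) (d_alpha F z) = 0).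
{ intros K K0 HK CK; apply (nonreal_path (fun _ => z) K); try assumption.
  - apply continuous_const.
  - rewrite K0; exact H0. }
destruct (P (rot_i J) Ri (fun t => imag_unit_rot_i J t HJ)) as [d1 H1].
{ apply continuous_quat; try apply continuous_const.
  - apply continuous_ext with (2 := Ct (qj J) (- qk J)); intros t; simpl; ring.
  - apply continuous_ext with (2 := Ct (qk J) (qj J)); intros t; simpl; ring. }
destruct (P (rot_j J) Rj (fun t => imag_unit_rot_j J t HJ)) as [d2 H2].
{ apply continuous_quat; try apply continuous_const.
  - apply continuous_ext with (2 := Ct (qi J) (qk J)); intros t; simpl; ring.
  - apply continuous_ext with (2 := Ct (qk J) (- qi J)); intros t; simpl; ring. }
destruct (P (rot_k J) Rk (fun t => imag_unit_rot_k J t HJ)) as [d3 H3].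
{ apply continuous_quat; try apply continuous_const.
  - apply continuous_ext with (2 := Ct (qi J) (- qj J)); intros t; simpl; ring.
  - apply continuous_ext with (2 := Ct (qj J) (qi J)); intros t; simpl; ring. }
assert (HPI := PI_RGT_0).
(* The bound [PI] puts the angle [m / 2] strictly between 0 and [PI], where the sine is positive and
   the cosine is below 1. *)
set (m := Rmin (Rmin d1 d2) (Rmin d3 PI)).
assert (Pm : 0 < m) by (repeat apply Rmin_glb_lt; try apply cond_pos; exact HPI).
assert (m <= d1 /\ m <= d2 /\ m <= d3 /\ m <= PI) as [M1 [M2 [M3 M4]]].
{ unfold m; pose proof (Rmin_l (Rmin d1 d2) (Rmin d3 PI)).
  pose proof (Rmin_r (Rmin d1 d2) (Rmin d3 PI)).
  pose proof (Rmin_l d1 d2); pose proof (Rmin_r d1 d2).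
  pose proof (Rmin_l d3 PI); pose proof (Rmin_r d3 PI); repeat split; lra. }
apply (cdot_slice_rotations J (snd (F z)) _ (m / 2)); [exact HJ|exact Nq|lra|].
intros t Ht.
assert (Bt : Rabs t < m).
{ destruct Ht as [->|[->| ->]]; [rewrite Rabs_pos_eq|rewrite Rabs_Ropp, Rabs_pos_eq|
    rewrite Rabs_R0]; lra. }
repeat split; [apply H1|apply H2|apply H3]; lra.
Qed.

Lemma nonreal_flat_segment (z : C) :
  D z -> Im z <> 0 -> d_alpha F z = ((0, 0, 0, 0), (0, 0, 0, 0)) ->
  exists d : posreal, forall s, Rabs s < d -> D (Re z + s, Im z) /\
    d_alpha F (Re z + s, Im z) = ((0, 0, 0, 0), (0, 0, 0, 0)).
Proof.
intros Hz Nz HA.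
set (p := fun s => (Re z + s, Im z) : C).
assert (Ep : p 0 = z) by (unfold p; rewrite Rplus_0_r; symmetry; apply surjective_pairing).
assert (Cp : continuous p 0).
{ apply continuous_pair; [|apply continuous_const].
  apply (continuous_plus (V := R_NormedModule)); [apply continuous_const|apply continuous_id]. }
(* Since the whole derivative vanishes at [z], the leading coefficient is 0 for every unit at once;
   the unit can stay fixed while the point moves. *)
assert (P : forall J, imag_unit J -> exists d : posreal, forall s, Rabs s < d ->
  cdot (opp (qmul J (snd (F (p s)))), snd (F (p s))) (d_alpha F (p s)) = 0).
{ intros J HJ; apply (nonreal_path p (fun _ => J)); rewrite ?Ep; try assumption.
  - apply continuous_const.
  - intros _; exact HJ.
  - rewrite HA, cdotE; unfold qdot; apply injective_projections; simpl; ring. }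
destruct (ball_in_open D z D_open Hz) as [e He].
assert (HpD : forall s, Rabs s < e -> D (p s)).
{ intros s Hs; apply He.
  replace (p s - z)%C with (RtoC s)
    by (destruct z; apply injective_projections; simpl; ring).
  rewrite Cmod_R; exact Hs. }
destruct (P _ imag_unit_i) as [d1 H1].
destruct (P (0, -1, 0, 0)) as [d2 H2].
{ apply imag_unitP; simpl; split; ring. }
destruct (P _ imag_unit_j) as [d3 H3]; destruct (P _ imag_unit_k) as [d4 H4].
set (m := Rmin e (Rmin (Rmin d1 d2) (Rmin d3 d4))).
assert (Pm : 0 < m) by (repeat apply Rmin_glb_lt; apply cond_pos).
exists (mkposreal m Pm); intros s Hs; simpl in Hs.
assert (m <= e /\ m <= d1 /\ m <= d2 /\ m <= d3 /\ m <= d4) as [M0 [M1 [M2 [M3 M4]]]].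
{ unfold m; pose proof (Rmin_l e (Rmin (Rmin d1 d2) (Rmin d3 d4))).
  pose proof (Rmin_r e (Rmin (Rmin d1 d2) (Rmin d3 d4))).
  pose proof (Rmin_l (Rmin d1 d2) (Rmin d3 d4)); pose proof (Rmin_r (Rmin d1 d2) (Rmin d3 d4)).
  pose proof (Rmin_l d1 d2); pose proof (Rmin_r d1 d2).
  pose proof (Rmin_l d3 d4); pose proof (Rmin_r d3 d4); repeat split; lra. }
assert (Ds : D (p s)) by (apply HpD; lra).
split; [exact Ds|].
apply (cdot_slice_span (snd (F (p s)))).
- apply (snd_stem_neq0 D); assumption.
- apply H1; lra.
- apply H2; lra.
- apply H3; lra.
- apply H4; lra.
Qed.

End Paths.

Theorem theorem33 (D : C -> Prop) (F : C -> quatC)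
    (D_open : open D)
    (D_symmetric : conj_symmetric D)
    (F_stem : is_stem D F)
    (F_regular : slice_regular D F)
    (f_injective : forall x y : quat,
       circularization D x -> circularization D y ->
       slice_fun F x = slice_fun F y -> x = y) :
  forall x : quat, circularization D x -> slice_derivative F x <> zero.
Proof.
intros x [a [b [J [Hz [HJ ->]]]]] H.
assert (Sdz := is_stem_d_z D F D_open D_symmetric F_stem (proj1 F_regular)).
unfold slice_derivative in H.
rewrite (slice_fun_slice_pt D) in H by assumption.
rewrite (d_z_slice_regular D) in H by assumption.
change (plus (fst (d_alpha F (a, b))) (qmul J (snd (d_alpha F (a, b)))) =
  (0, 0, 0, 0)) in H.
assert (HA : d_alpha F (a, b) =
  (opp (qmul J (snd (d_alpha F (a, b)))), snd (d_alpha F (a, b)))).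
{ rewrite (surjective_pairing (d_alpha F (a, b))) at 1; f_equal.
  exact (plus_eq_zero _ _ H). }
assert (flat : exists d : posreal, forall s, Rabs s < d -> D (Re (a, b) + s, Im (a, b)) /\
  d_alpha F (Re (a, b) + s, Im (a, b)) = ((0, 0, 0, 0), (0, 0, 0, 0))).
{ destruct (Req_dec b 0) as [->|Nb].
  - apply (real_path D F D_open F_stem F_regular f_injective a D_symmetric Hz).
    pose proof (stem_real_axis D (d_z F) a Sdz Hz) as Z.
    rewrite (d_z_slice_regular D) in Z by assumption.
    rewrite HA, Z; unfold qmul; destruct J as [[[j0 j1] j2] j3].
    rewrite quat_oppE; repeat f_equal; ring.
  - assert (HJF : d_alpha F (a, b) = ((0, 0, 0, 0), (0, 0, 0, 0))).
    { apply (nonreal_flat D F D_open F_stem F_regular f_injective _ J); try assumption.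
      rewrite HA; apply cdot_slice_same_unit, HJ. }
    exact (nonreal_flat_segment D F D_open F_stem F_regular f_injective _ Hz Nb HJF). }
destruct flat as [d Hd].
exact (injective_no_flat_segment D F (a, b) d F_regular F_stem f_injective Hd).
Qed.
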